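(* Let $0<\lambda<\mu$, and let $A$ and $S$ be independent homogeneous Poisson processes on $\mathbb{R}$ with respective intensities $\lambda$ and $\mu$. For $t\in\mathbb{R}$ set $$Q(t)=\sup_{s\le t}\,\bigl[A(s,t]-S(s,t]\bigr]^+ ,$$ and define the point processes $D$, $U$ and $T$ on $\mathbb{R}$ by $$D(s,t]=A(s,t]+Q(s)-Q(t)\quad (s<t),\qquad U=S-D,\qquad T=A+U .$$ Then $D$ and $T$ are independent homogeneous Poisson processes on $\mathbb{R}$ with respective intensities $\lambda$ and $\mu$.
   Context: For a point process $X$ on $\mathbb{R}$ and an interval $I$, $X(I)$ denotes the number of points (mass) of $X$ in $I$; in particular $X(s,t]$ is the mass of $(s,t]$, and $X(s,s]=0$. Sums and differences of point processes are taken as sums and differences of the associated measures. $[x]^+=\max(x,0)$. This is the stationary M/M/1 queue: $A$ is the arrivals process, $S$ the service process, $Q$ the queue-length process, $D$ the departure process and $U$ the unused service process. *)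

(* Defs.v *)
From HB Require Import structures.
From mathcomp Require Import all_boot all_order all_algebra.
From mathcomp Require Import all_classical all_reals all_analysis.
From mathcomp Require Import measurable_realfun.
Import Order.TTheory GRing.Theory Num.Theory.
Import numFieldNormedType.Exports.

Set Implicit Arguments.
Unset Strict Implicit.
Unset Printing Implicit Defensive.

Local Open Scope classical_set_scope.
Local Open Scope ring_scope.
Local Open Scope ereal_scope.

(* A point process on the line is a random measure (a measurable kernel from
   the sample space to R) taking finite integer values on bounded Borel sets. *)
Definition point_process (R : realType) (d : measure_display)
    (Omega : measurableType d) (X : R.-ker Omega ~> R) : Prop :=
  forall (w : Omega) (B : set R), measurable B -> bounded_set B ->
    exists n : nat, X w B = n%:R%:E.

Definition mutually_independent (R : realType) (d : measure_display)
    (Omega : measurableType d) (P : probability Omega R) (n : nat)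
    (Y : 'I_n -> Omega -> \bar R) : Prop :=
  forall C : 'I_n -> set (\bar R), (forall i, measurable (C i)) ->
    P [set w | forall i, C i (Y i w)] = \prod_(i < n) P (Y i @^-1` C i).

(* For r > 0, poisson_pmf r k = r ^ k / k! * exp (- r). *)
Definition poisson_process (R : realType) (d : measure_display)
    (Omega : measurableType d) (P : probability Omega R) (rate : R)
    (X : R.-ker Omega ~> R) : Prop :=
  [/\ point_process X,
      forall (s t : R) (k : nat), (s < t)%R ->
        P [set w | X w `]s, t]%classic = k%:R%:E]
        = (poisson_pmf (rate * (t - s))%R k)%:E
    & forall (n : nat) (s t : 'I_n -> R), (forall i, (s i < t i)%R) ->
        trivIset setT (fun i => `]s i, t i]%classic) ->
        mutually_independent P (fun i w => X w `]s i, t i]%classic)].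

Definition sigma_process (R : realType) (d : measure_display)
    (Omega : measurableType d) (X : R.-ker Omega ~> R) : set (set Omega) :=
  <<s [set E | exists B : set R, exists C : set (\bar R),
         [/\ measurable B, measurable C & E = (X ^~ B) @^-1` C]] >>.

Definition independent_processes (R : realType) (d : measure_display)
    (Omega : measurableType d) (P : probability Omega R)
    (X Y : R.-ker Omega ~> R) : Prop :=
  forall E F : set Omega, sigma_process X E -> sigma_process Y F ->
    P (E `&` F) = P E * P F.

Definition queue_length (R : realType) (d : measure_display)
    (Omega : measurableType d) (A S : R.-ker Omega ~> R)
    (w : Omega) (t : R) : \bar R :=
  ereal_sup [set maxe (A w `]s, t]%classic - S w `]s, t]%classic) 0
            | s in [set s | (s <= t)%R]].

(* The queue length is finite only almost surely, so the three processes
   below are specified up to a negligible set of outcomes. *)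
Definition is_departure (R : realType) (d : measure_display)
    (Omega : measurableType d) (P : probability Omega R)
    (A S D : R.-ker Omega ~> R) : Prop :=
  point_process D /\
  {ae P, forall w, forall s t : R, (s < t)%R ->
    D w `]s, t]%classic
    = A w `]s, t]%classic + queue_length A S w s - queue_length A S w t}.

(* Differences of measures are taken on bounded Borel sets, where both masses
   are finite; elsewhere +oo - +oo could occur. *)
Definition is_difference (R : realType) (d : measure_display)
    (Omega : measurableType d) (P : probability Omega R)
    (X Y Z : R.-ker Omega ~> R) : Prop :=
  point_process Z /\
  {ae P, forall w, forall B : set R, measurable B -> bounded_set B ->
    Z w B = X w B - Y w B}.

Definition is_sum (R : realType) (d : measure_display)
    (Omega : measurableType d) (P : probability Omega R)
    (X Y Z : R.-ker Omega ~> R) : Prop :=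
  point_process Z /\
  {ae P, forall w, forall B : set R, measurable B -> Z w B = X w B + Y w B}.

(* D = departures, U = unused services = S - D, T = A + U. *)
Definition mm1_outputs (R : realType) (d : measure_display)
    (Omega : measurableType d) (P : probability Omega R)
    (A S D U T : R.-ker Omega ~> R) : Prop :=
  [/\ is_departure P A S D, is_difference P S D U & is_sum P A U T].

(* Main.v *)
Require Import Defs.
From HB Require Import structures.
From mathcomp Require Import all_boot all_order all_algebra.
From mathcomp Require Import all_classical all_reals all_analysis.
From mathcomp Require Import measurable_realfun.
From mathcomp Require Import ring lra zify.
Import Order.TTheory GRing.Theory Num.Theory.
Import numFieldNormedType.Exports.

(** The proof discretises time.

    Discrete time. Let every slot carry independent bits [a], of parameter [p]
    (an arrival), and [s], of parameter [q > p] (a service). One slot sends the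
    queue length and the bits [(a, s)] to the next queue length and the bits
    [(d, t)] of the departures and of T. This map is a bijection, and it preserves
    the product of the geometric law of ratio [rho] with the laws of the two bits
    ([burke_step]). By induction a queue started from the geometric law turns the
    input bits into output bits of the same joint law ([burke_run]). Two queues fed
    with the same bits merge as soon as the longer one would have been emptied
    ([qrun_coupling]), so that the queue which starts empty has almost the right
    output law ([burke_empty]).

    Continuous time. A long interval is cut into cells of length [h], and each cell
    records whether it holds an arrival and whether it holds a service. For
    independent Poisson processes these bits are independent, and their ratio
    [rho] stays below [lambda / mu] whatever [h] ([rho_poisson_le]). Apart from an
    event of small probability, no cell holds two points ([pr_crowded]), rounding
    up the endpoints of finitely many given intervals jumps over no point, and in
    the remote past services outnumber arrivals ([pr_overload_tail]). On such paths
    the queue length at the grid times obeys the discrete recursion, and the counts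
    of D and T in the given intervals are the same functions of the output bits as
    the counts of A and S are of the input bits ([in_out_npts]). Letting the
    number of cells grow, the counts of (D, T) and of (A, S) in any finite family
    of intervals have the same joint law ([transfer]). No limit law has to be
    computed: the Poisson laws and the independence of D and T are read off those
    of A and S, and the independence is extended from cylinder events to the
    generated sigma-algebras by the pi-lambda theorem ([burke]).

    Existence. By Chernoff's bound and Borel-Cantelli the queue length is almost
    surely finite ([stable_ae]). Then [A(s,t] + Q(s) - Q(t)] and its complement to
    [S(s,t]] are nonnegative integers, bounded by [S(s,t]]: they are the increments
    of nondecreasing right-continuous functions, whose Lebesgue-Stieltjes measures
    are D and U ([mm1_outputs_exist]). *)

Set Implicit Arguments.
Unset Strict Implicit.
Unset Printing Implicit Defensive.

Local Open Scope classical_set_scope.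
Local Open Scope ring_scope.

(** * The queue in discrete time *)

Section discrete_queue.
Local Open Scope nat_scope.
Implicit Types (q : nat) (x : bool * bool) (l : seq (bool * bool)).

Definition qstep q x : nat := (q + x.1) - x.2.
(** The bits of D and T: a service is a departure when a customer is present,
    those just arrived included; an unused one is turned into a point of T. *)
Definition ostep q x : bool * bool :=
  (x.2 && (x.1 || (0 < q)), x.1 || (x.2 && (q == 0))).
Definition qrun q l : nat := foldl qstep q l.
Fixpoint orun q l : seq (bool * bool) :=
  if l is x :: l' then ostep q x :: orun (qstep q x) l' else [::].
Definition arrivals l : nat := \sum_(x <- l) x.1.
Definition services l : nat := \sum_(x <- l) x.2.

Lemma qrun_cat q l1 l2 : qrun q (l1 ++ l2) = qrun (qrun q l1) l2.
Proof. exact: foldl_cat. Qed.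

Lemma orun_drop q k l : drop k (orun q l) = orun (qrun q (take k l)) (drop k l).
Proof.
by elim: l k q => [|x l IH] [|k] q //=; rewrite IH.
Qed.

Lemma take_orun q k l : take k (orun q l) = orun q (take k l).
Proof. by elim: l k q => [|x l IH] [|k] q //=; rewrite IH. Qed.

Lemma arrivals_cons x l : arrivals (x :: l) = x.1 + arrivals l.
Proof. by rewrite /arrivals big_cons. Qed.

Lemma services_cons x l : services (x :: l) = x.2 + services l.
Proof. by rewrite /services big_cons. Qed.

Lemma qrun_ge q l : q + arrivals l <= qrun q l + services l.
Proof.
elim: l q => [|[a s] l IH] q /=; first by rewrite /arrivals /services !big_nil.
have := IH (qstep q (a, s)); rewrite arrivals_cons services_cons /qstep /=.
by move: (qrun _ _) (arrivals _) (services _) => ? ? ?; lia.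
Qed.

(** A queue of length [q] merges with the empty one as soon as it would have
    been emptied, and runs along with it ever after. *)
Lemma qrun_max q l :
  qrun q l = maxn (qrun 0 l) (q + arrivals l - services l).
Proof.
elim: l q => [|[a s] l IH] q /=; first by rewrite /arrivals /services !big_nil; lia.
rewrite IH [qrun (qstep 0 _) _]IH arrivals_cons services_cons.
have := qrun_ge 0 l; rewrite /qstep /=.
by move: (qrun _ _) (arrivals _) (services _) => ? ? ?; lia.
Qed.

Lemma qrun_coupling q l : q + arrivals l <= services l -> qrun q l = qrun 0 l.
Proof. by move=> ?; rewrite qrun_max; lia. Qed.

(** Conservation of customers, with the departures stored as first bits. *)
Lemma arrivals_orun q l : arrivals (orun q l) + qrun q l = q + arrivals l.
Proof.
elim: l q => [|[a s] l IH] q /=; first by rewrite /arrivals !big_nil addn0.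
rewrite !arrivals_cons /= -addnA IH /qstep/=.
by case: a; case: s => /=; lia.
Qed.

(** This is [D + T = A + S]. *)
Lemma services_orun q l :
  arrivals (orun q l) + services (orun q l) = arrivals l + services l.
Proof.
elim: l q => [|[a s] l IH] q /=; first by rewrite /arrivals /services !big_nil.
have := IH (qstep q (a, s)); rewrite !arrivals_cons !services_cons /=.
by case: a; case: s => /=; case: q => [|q] /=; lia.
Qed.

End discrete_queue.

(** * Burke's theorem in discrete time *)

Section discrete_burke.
Variables (R : realFieldType) (p q : R).
Hypotheses (p0 : 0 < p) (p1 : p < 1) (q0 : 0 < q) (q1 : q < 1).

Definition bern (r : R) (b : bool) : R := if b then r else 1 - r.

Definition wgt (x : bool * bool) : R := bern p x.1 * bern q x.2.

(** The expectation of [F] over [N] independent slots, by recursion on the slots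
    so that [burke_run] is a direct induction. *)
Fixpoint expect (N : nat) (F : seq (bool * bool) -> R) : R :=
  if N is N'.+1 then
    \sum_(x : bool * bool) wgt x * expect N' (fun l => F (x :: l))
  else F [::].

Lemma bern_ge0 r b : 0 < r -> r < 1 -> 0 <= bern r b.
Proof. by move=> ? ?; rewrite /bern; case: b; lra. Qed.

Lemma wgt_ge0 x : 0 <= wgt x.
Proof. by rewrite mulr_ge0 ?bern_ge0. Qed.

Lemma eq_expect N F G : F =1 G -> expect N F = expect N G.
Proof.
elim: N F G => [|N IH] F G FG //=.
by apply: eq_bigr => x _; congr (_ * _); apply: IH => l.
Qed.

Lemma expect_ge0 N F : (forall l, 0 <= F l) -> 0 <= expect N F.
Proof.
elim: N F => [|N IH] F F0 //=.
by apply: sumr_ge0 => x _; rewrite mulr_ge0 ?wgt_ge0 ?IH.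
Qed.

Lemma sum_bool2 (f : bool * bool -> R) : \sum_(x : bool * bool) f x =
  f (false, false) + f (false, true) + f (true, false) + f (true, true).
Proof.
have -> : \sum_(x : bool * bool) f x = \sum_a \sum_b f (a, b).
  by rewrite pair_bigA /=; apply: eq_bigr => -[].
by rewrite !big_bool/=; ring.
Qed.

(** The ratio of the stationary geometric law: in one slot the queue grows with
    probability [p * (1 - q)] and shrinks with probability [q * (1 - p)]. *)
Definition rho : R := (p * (1 - q)) / (q * (1 - p)).

Lemma rhoE : rho * (q * (1 - p)) = p * (1 - q).
Proof. by rewrite /rho divfK// mulf_neq0// lt0r_neq0// subr_gt0. Qed.

Lemma rho_ge0 : 0 <= rho.
Proof. by rewrite /rho divr_ge0// mulr_ge0// ?ltW ?subr_gt0. Qed.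

(** The local form of Burke's theorem. Sending the queue length and the two
    bits of a slot to the next queue length and the two output bits is a
    bijection which preserves the weight [rho ^+ i * wgt x]. Truncating at [K]
    only asks for an inequality, because the window [i < K] is mapped into
    [i < K.+1]; finite sums suffice in this way. *)
Lemma burke_step K (G : nat -> bool * bool -> R) : (forall i x, 0 <= G i x) ->
  \sum_(i < K) rho ^+ i * \sum_x wgt x * G (qstep i x) (ostep i x) <=
  \sum_(i < K.+1) rho ^+ i * \sum_x wgt x * G i x.
Proof.
move=> G0.
pose L i := rho ^+ i * \sum_x wgt x * G (qstep i x) (ostep i x).
pose M i := rho ^+ i * \sum_x wgt x * G i x.
rewrite -(big_mkord xpredT L) -(big_mkord xpredT M).
have rn i : 0 <= rho ^+ i by rewrite exprn_ge0 ?rho_ge0.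
(* The image of [i < J.+1] is the part [i < J] of the right-hand side, the
   outputs of [J] with no bit, both bits or the bit of T alone, and the output
   of [J.+1] with the bit of T alone. *)
have key : forall J, \sum_(0 <= i < J.+1) L i = \sum_(0 <= i < J) M i +
   rho ^+ J * ((1-p) * (1-q) * G J (false,false) + p * q * G J (true,true)
     + (1-p) * q * G J (false,true)) + rho ^+ J.+1 * ((1-p)*q* G J.+1 (false,true)).
  elim=> [|J IH].
    rewrite big_nat1 big_geq// add0r /L sum_bool2 /wgt /bern /qstep /ostep /=.
    rewrite !expr0 !mul1r expr1 -[rho * _]/(rho * ((1-p)*q* _)) [in RHS](mulrC (1-p) q).
    rewrite [rho * _]mulrA rhoE.
    by ring.
  rewrite big_nat_recr//= IH big_nat_recr//= /L /M !sum_bool2 /wgt /bern /qstep /ostep /=.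
  rewrite !(subn0, subn1, addn0, addn1) /=.
  rewrite [in LHS](exprSr rho J) [in RHS](exprSr rho J.+1) [in RHS](exprSr rho J).
  set r := rho ^+ J.
  have e := rhoE.
  (* The slot bits (0,1) at [J.+1] yield the bits (1,0) at
     [J], and (1,0) at [J.+1] yields (0,1) at [J.+2]. *)
  have e1 : forall z, r * rho * (q * (1-p) * z) = r * (p * (1-q) * z).
    by move=> z; rewrite -e; ring.
  have e2 : forall z, r * rho * rho * (q * (1-p) * z) = r * rho * (p * (1-q) * z).
    by move=> z; rewrite -e; ring.
  have -> : r * rho * rho * ((1 - p) * q * G J.+2 (false, true)) =
    r * rho * rho * (q * (1 - p) * G J.+2 (false, true)) by ring.
  rewrite e2.
  have -> : r * rho *
    ((1 - p) * (1 - q) * G J.+1 (false, false) + (1 - p) * q * G J ((0 < J.+1)%N, J.+1 == 0%N) +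
     p * (1 - q) * G J.+2 (false, true) + p * q * G J.+1 (true, true)) =
    r * rho *
    ((1 - p) * (1 - q) * G J.+1 (false, false) +
     p * (1 - q) * G J.+2 (false, true) + p * q * G J.+1 (true, true))
     + r * rho * (q * (1-p) * G J (true, false)) by ring.
  rewrite e1.
  by ring.
case: K => [|K].
  rewrite big_geq// big_nat1 mulr_ge0// sumr_ge0// => x _.
  by rewrite mulr_ge0 ?wgt_ge0.
rewrite key big_nat_recr//= big_nat_recr//= -!addrA lerD2l.
rewrite /M !sum_bool2 /wgt /bern/=.
set u := rho ^+ K; set v := rho ^+ K.+1.
have u0 : 0 <= u := rn K. have v0 : 0 <= v := rn K.+1.
have [? ? ? ?] : [/\ 0 <= 1 - p, 0 <= 1 - q, 0 <= p & 0 <= q].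
  by rewrite !subr_ge0 !ltW.
rewrite -subr_ge0.
set X := (X in 0 <= X).
suff -> : X = u * (p * (1-q) * G K (true,false)) + v * ((1 - p) * (1 - q) * G K.+1 (false, false) +
      p * (1 - q) * G K.+1 (true, false) + p * q * G K.+1 (true, true)).
  by rewrite addr_ge0// mulr_ge0// ?addr_ge0// mulr_ge0// ?mulr_ge0.
by rewrite /X; ring.
Qed.

(** The window grows by one at each slot, whence [K + N]. *)
Lemma burke_run N K (F : seq (bool * bool) -> R) : (forall l, 0 <= F l) ->
  \sum_(i < K) rho ^+ i * expect N (F \o orun i) <=
  (\sum_(i < K + N) rho ^+ i) * expect N F.
Proof.
elim: N K F => [|N IH] K F F0 /=.
  by rewrite addn0 mulr_suml.
pose G i y := expect N (fun l => F (y :: orun i l)).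
apply: (le_trans (burke_step K (G := G) _)); first by move=> i x; exact: expect_ge0.
rewrite addnS -addSn.
set S := \sum_(i < _ + _) _.
have -> : \sum_(i < K.+1) rho ^+ i * \sum_x wgt x * G i x =
    \sum_x wgt x * \sum_(i < K.+1) rho ^+ i * G i x.
  under eq_bigr do rewrite mulr_sumr.
  rewrite exchange_big; apply: eq_bigr => x _.
  by rewrite mulr_sumr; apply: eq_bigr => i _; rewrite mulrCA.
rewrite mulr_sumr; apply: ler_sum => x _.
rewrite [leRHS]mulrCA ler_wpM2l ?wgt_ge0//.
exact: IH.
Qed.

End discrete_burke.

(** * Real-valued probabilities *)

Lemma fsum_finType (R : realType) (I : finType) (F : I -> \bar R) :
  (\sum_(i \in [set: I]) F i = \sum_i F i)%E.
Proof.
rewrite (fsbigE (index_enum I)) ?index_enum_uniq//.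
  by apply: eq_bigl => i; rewrite in_setT.
by move=> i _; rewrite mem_index_enum.
Qed.

Section real_valued_probability.
Context (R : realType) (d : measure_display) (Omega : measurableType d)
  (P : probability Omega R).
Implicit Types A B : set Omega.

Definition pr A : R := fine (P A).

Lemma prE A : measurable A -> P A = (pr A)%:E.
Proof. by move=> mA; rewrite /pr fineK// fin_num_measure. Qed.

Lemma pr_ge0 A : 0 <= pr A.
Proof. by rewrite /pr fine_ge0. Qed.

Lemma le_pr A B : measurable A -> measurable B -> A `<=` B -> pr A <= pr B.
Proof.
by move=> mA mB AB; rewrite -lee_fin -!prE// le_measure// inE.
Qed.

Lemma pr_le1 A : measurable A -> pr A <= 1.
Proof. by move=> mA; rewrite -lee_fin -prE// probability_le1. Qed.

Lemma pr_setC A : measurable A -> pr (~` A) = 1 - pr A.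
Proof.
move=> mA; apply: EFin_inj.
by rewrite -prE ?probability_setC//; [rewrite prE|exact: measurableC].
Qed.

Lemma pr_setU A B : measurable A -> measurable B -> pr (A `|` B) <= pr A + pr B.
Proof.
move=> mA mB; rewrite -lee_fin EFinD -!prE//; last exact: measurableU.
exact: measureU2.
Qed.

Lemma pr_disjU A B : measurable A -> measurable B -> A `&` B = set0 ->
  pr (A `|` B) = pr A + pr B.
Proof.
move=> mA mB AB; apply: EFin_inj; rewrite EFinD -!prE//; last exact: measurableU.
by rewrite measureU.
Qed.

Lemma le_pr_setU A B C : measurable A -> measurable B -> measurable C ->
  A `<=` B `|` C -> pr A <= pr B + pr C.
Proof.
move=> mA mB mC ABC; apply: (le_trans _ (pr_setU mB mC)).
by apply: le_pr => //; exact: measurableU.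
Qed.

Lemma pr_bigsetU (I : finType) (F : I -> set Omega) :
  (forall i, measurable (F i)) -> pr (\bigcup_i F i) <= \sum_i pr (F i).
Proof.
move=> mF; rewrite -lee_fin -prE; last exact: fin_bigcup_measurable.
have mU : measurable (\bigcup_i F i) by exact: fin_bigcup_measurable.
rewrite -sumEFin (le_trans (@content_sub_fsum _ _ _ _ _ setT _ _ _ _ mU (@subset_refl _ _)))//.
  exact: finite_finset.
by rewrite fsum_finType; apply: lee_sum => i _; rewrite -prE.
Qed.

Lemma pr_partition (I : finType) (f : Omega -> I) A :
  (forall i, measurable (A `&` f @^-1` [set i])) ->
  measurable A /\ pr A = \sum_i pr (A `&` f @^-1` [set i]).
Proof.
move=> mf; have AE : A = \bigcup_i (A `&` f @^-1` [set i]).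
  by rewrite -setI_bigcupr; apply/seteqP; split=> [w Aw|w []//]; split=> //; exists (f w).
have mA : measurable A by rewrite AE; apply: fin_bigcup_measurable.
split=> //; apply: EFin_inj; rewrite -prE// -sumEFin {1}AE.
rewrite measure_fin_bigcup//.
- by rewrite fsum_finType; apply: eq_bigr => i _; exact: prE.
- exact: finite_finset.
- by move=> i j _ _ [w [[_ <-] [_ <-]]].
Qed.

End real_valued_probability.

(** * Burke's theorem for random bits *)

Section random_bits.
Context (R : realType) (d : measure_display) (Omega : measurableType d)
  (P : probability Omega R).
Variables (p q : R) (N : nat) (f : Omega -> seq (bool * bool)).
Hypothesis size_f : forall w, size (f w) = N.
Hypothesis mf : forall l, size l = N -> measurable [set w | f w = l].
Hypothesis prf : forall l, size l = N ->
  pr P [set w | f w = l] = \prod_(x <- l) wgt p q x.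

(** The bits are revealed one slot at a time, in the order in which [expect]
    sums over them. *)
Lemma pr_prefix k (l : seq (bool * bool)) (F : pred (seq (bool * bool))) :
  (size l + k)%N = N ->
  measurable [set w | take (size l) (f w) = l /\ F (f w)] /\
  pr P [set w | take (size l) (f w) = l /\ F (f w)] =
  \prod_(x <- l) wgt p q x * expect p q k (fun l' => (F (l ++ l'))%:R).
Proof.
elim: k l => [|k IH] l lN.
  rewrite addn0 in lN; rewrite /= cats0.
  have -> : [set w | take (size l) (f w) = l /\ F (f w)] =
            if F l then [set w | f w = l] else set0.
    apply/seteqP; split=> w /=.
      by rewrite take_oversize ?size_f ?lN// => -[fl]; rewrite fl => ->.
    by case: ifP => //= Fl fl; rewrite fl take_oversize// Fl.
  case: ifP => _; rewrite ?mulr1 ?mulr0; split=> //; [exact: mf|exact: prf|].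
  by rewrite /pr measure0.
pose g w := nth (false, false) (f w) (size l).
have gE x : [set w | take (size l) (f w) = l /\ F (f w)] `&` g @^-1` [set x] =
    [set w | take (size (rcons l x)) (f w) = rcons l x /\ F (f w)].
  apply/seteqP; split=> w /=.
    move=> [[tl ->] gx]; split=> //.
    by rewrite size_rcons (take_nth (false, false)) ?size_f -?lN ?tl -?gx// addnS ltnS leq_addr.
  rewrite size_rcons (take_nth (false, false)) ?size_f -?lN// ?addnS ?ltnS ?leq_addr//.
  by move=> [/rcons_inj[-> <-] ->].
have lN' x : (size (rcons l x) + k)%N = N by rewrite size_rcons addSnnS.
have [|mE ->] := @pr_partition _ _ _ P _ g [set w | take (size l) (f w) = l /\ F (f w)].
  by move=> x; rewrite gE; exact: (IH _ (lN' x)).1.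
split=> //; rewrite /= mulr_sumr; apply: eq_bigr => x _.
rewrite gE (IH _ (lN' x)).2 big_rcons /=.
under eq_expect do rewrite cat_rcons.
by rewrite [RHS]mulrA; congr (_ * _); rewrite [RHS]mulrC.
Qed.

Lemma measurable_bits (F : pred (seq (bool * bool))) :
  measurable [set w | F (f w)].
Proof.
have [+ _] := @pr_prefix N [::] F (add0n _).
by congr (measurable _); apply/seteqP; split=> w /=; [case|split=> //; exact: take0].
Qed.

Lemma pr_bits (F : pred (seq (bool * bool))) :
  pr P [set w | F (f w)] = expect p q N (fun l => (F l)%:R).
Proof.
have [_ +] := @pr_prefix N [::] F (add0n _).
rewrite big_nil mul1r => <-; congr (pr _ _).
by apply/seteqP; split=> w /=; [split=> //; exact: take0|case].
Qed.

Hypotheses (p0 : 0 < p) (pq : p < q) (q1 : q < 1).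

Lemma rho_lt1 : rho p q < 1.
Proof.
have q0 : 0 < q := lt_trans p0 pq; have p1 : p < 1 := lt_trans pq q1.
rewrite /rho ltr_pdivrMr ?mulr_gt0 ?subr_gt0// mul1r -subr_gt0.
rewrite (_ : _ - _ = q - p) ?subr_gt0//; by ring.
Qed.

Lemma geometric_mass K (r : R) : (1 - r) * (\sum_(i < K) r ^+ i) = 1 - r ^+ K.
Proof. by rewrite -opprB mulNr -subrX1 opprB. Qed.

(** The queue that starts empty has the output law of the queue in equilibrium
    up to the probability that the two differ: either the latter starts from [K]
    customers or more, or the two have not merged. *)
Lemma burke_empty_le K (F : pred (seq (bool * bool))) (bad : set Omega) :
  measurable bad ->
  (forall i w, (i < K)%N -> ~ bad w -> F (orun i (f w)) = F (orun 0 (f w))) ->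
  pr P [set w | F (orun 0 (f w))] <=
  pr P [set w | F (f w)] + pr P bad + rho p q ^+ K.
Proof.
have q0 : 0 < q := lt_trans p0 pq; have p1 : p < 1 := lt_trans pq q1.
move=> mbad badP; set r := rho p q.
have r1 : r < 1 := rho_lt1.
have r0 : 0 <= r by exact: rho_ge0.
set p0' := pr P _; set pF := pr P _; set b := pr P bad.
have mF i : measurable [set w | F (orun i (f w))].
  exact: (measurable_bits (fun l => F (orun i l))).
have step : (1 - r ^+ K) * (p0' - b) <= pF.
  rewrite -geometric_mass -mulrA.
  have pFE : pF = expect p q N (fun l => (F l)%:R) by exact: pr_bits.
  have F0 l : 0 <= (F l)%:R :> R by rewrite ler0n.
  apply: (@le_trans _ _ ((1 - r) * ((\sum_(i < K + N) r ^+ i) * pF))); last first.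
    rewrite mulrA geometric_mass ler_piMl ?pr_ge0//.
    by rewrite gerBl exprn_ge0.
  rewrite ler_wpM2l ?subr_ge0 ?(ltW r1)// pFE.
  apply: le_trans (burke_run p0 p1 q0 q1 N K F0).
  rewrite mulr_suml; apply: ler_sum => i _.
  rewrite ler_wpM2l ?exprn_ge0//.
  rewrite -(pr_bits (fun l => F (orun i l))) lerBlDr.
  apply: le_pr_setU => // w /= Fw.
  have [|nb] := pselect (bad w); first by right.
  by left; rewrite badP.
have b0 : 0 <= b by exact: pr_ge0.
have p01 : p0' <= 1 by exact: pr_le1.
have rK0 : 0 <= r ^+ K by rewrite exprn_ge0.
have : r ^+ K * (p0' - b) <= r ^+ K.
  by rewrite ler_piMr// lerBlDr (le_trans p01)// lerDl.
move: step; move: (p0') (b) (r ^+ K) (pF) => x y z t; lra.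
Qed.

(** The converse inequality is the previous one for the complementary event. *)
Lemma burke_empty K (F : pred (seq (bool * bool))) (bad : set Omega) :
  measurable bad ->
  (forall i w, (i < K)%N -> ~ bad w -> F (orun i (f w)) = F (orun 0 (f w))) ->
  `|pr P [set w | F (orun 0 (f w))] - pr P [set w | F (f w)]| <=
  pr P bad + rho p q ^+ K.
Proof.
move=> mbad badP; rewrite ler_norml; apply/andP; split; last first.
  by rewrite lerBlDl addrA; exact: burke_empty_le.
have := @burke_empty_le K (predC F) bad mbad.
have compl (g : Omega -> seq (bool * bool)) :
    [set w | predC F (g w)] = ~` [set w | F (g w)].
  by apply/seteqP; split=> w /= /negP.
rewrite !compl !pr_setC; [|exact: measurable_bits|exact: (measurable_bits (fun l => F (orun 0 l)))].
set x := pr P _; set y := pr P _; set z := pr P bad + _.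
rewrite -addrA -/z => H.
have : 1 - x <= 1 - y + z by apply: H => i w iK nb /=; rewrite badP.
by lra.
Qed.

End random_bits.

(** * Exponential and Poisson estimates *)

Section exponential_estimates.
Context (R : realType).
Implicit Types x y z r : R.

Lemma expRN_mul1D x : (1 + x) * expR (- x) <= 1.
Proof. by rewrite -[leRHS](expRxMexpNx_1 x) ler_wpM2r ?expR_ge0 ?expR_ge1Dx. Qed.

Lemma subr_expRN_le x : 1 - expR (- x) <= x.
Proof. by have := expR_ge1Dx (- x); lra. Qed.

(** The slope of [expR] from 0 is nondecreasing. This is elementary: bounding
    [expR y] below by [expR x * (1 + (y - x))] leaves the factor
    [(y - x) * (1 - expR x * (1 - x))], which is nonnegative. *)
Lemma expR_slope_le x y : 0 <= x -> x <= y -> (expR x - 1) * y <= x * (expR y - 1).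
Proof.
move=> x0 xy.
have h1 : expR x * (1 - x) <= 1 by have := expRN_mul1D (- x); rewrite opprK mulrC.
have h2 : expR x * (1 + (y - x)) <= expR y.
  by rewrite -[in leRHS](subrKC x y) expRD ler_wpM2l ?expR_ge0 ?expR_ge1Dx.
have h3 : 0 <= (y - x) * (1 - expR x * (1 - x)) by rewrite mulr_ge0 ?subr_ge0.
have h4 : x * (expR x * (1 + (y - x))) <= x * expR y by rewrite ler_wpM2l.
by nra.
Qed.

(** The bits of a cell have parameters [1 - expR (- x)] and [1 - expR (- y)], where
    [x / y = lambda / mu] whatever the length of the cell. *)
Lemma rho_poisson_le x y : 0 < x -> x < y ->
  rho (1 - expR (- x)) (1 - expR (- y)) <= x / y.
Proof.
move=> x0 xy; have y0 := lt_trans x0 xy.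
rewrite /rho !subKr ler_pdivrMr; last first.
  by rewrite mulr_gt0 ?expR_gt0// subr_gt0 expR_lt1 oppr_lt0.
rewrite mulrAC ler_pdivlMr//.
have := expR_slope_le (ltW x0) (ltW xy).
rewrite -(ler_pM2r (mulr_gt0 (expR_gt0 (- x)) (expR_gt0 (- y)))).
have := expRxMexpNx_1 x; have := expRxMexpNx_1 y.
move: (expR x) (expR y) (expR (- x)) (expR (- y)) => a b a' b' ey ex.
rewrite [X in X <= _](_ : _ = (a * a' - a') * b' * y); last by ring.
rewrite [X in _ <= X](_ : _ = x * (b * b' - b') * a'); last by ring.
by rewrite ex ey mulrA.
Qed.

Lemma sum_poisson_pmf r : 0 < r -> (\sum_(k <oo) (poisson_pmf r k)%:E = 1)%E.
Proof.
move=> r0; rewrite nneseries_esumT; last by move=> n; exact: poisson_pmf_ge0.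
have <- : poisson_prob r 0%N [set: nat] = 1%E by exact: probability_setT.
by rewrite /poisson_prob r0.
Qed.

(** The tilted Poisson law is a Poisson law, which gives Chernoff's bounds. *)
Lemma poisson_pmf_tilt r z k : 0 < r -> 0 < z ->
  z ^+ k * poisson_pmf r k = expR (r * (z - 1)) * poisson_pmf (r * z) k.
Proof.
move=> r0 z0; rewrite /poisson_pmf r0 mulr_gt0// exprMn.
rewrite mulrBr mulr1 expRD mulrCA !mulrA.
rewrite -[_ * expR (- (r * z))]mulrA.
have := expRxMexpNx_1 (r * z).
move: (expR _) (expR (- (r * z))) => a b.
move: (expR _) (k`!%:R^-1) (r ^+ k) (z ^+ k) => c e f g ab.
rewrite [RHS](_ : _ = (a * b) * (c * (f * g) * e)); last by ring.
by rewrite ab; ring.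
Qed.

End exponential_estimates.

(** * Counting points in intervals *)

Lemma natr_EFin_inj (R : realType) (m n : nat) :
  m%:R%:E = n%:R%:E :> \bar R -> m = n.
Proof. by case=> /eqP; rewrite eqr_nat => /eqP. Qed.

Section counting.
Context (R : realType) (d : measure_display) (Omega : measurableType d).
Implicit Types (X : R.-ker Omega ~> R) (s t u : R).

Definition npts X s t (w : Omega) : nat := Num.truncn (fine (X w `]s, t]%classic)).

Lemma bounded_itvoc s t : bounded_set (`]s, t]%classic : set R).
Proof.
exists (`|s| + `|t|); split; first by rewrite num_real.
move=> x xM y /=; rewrite in_itv/= => /andP[sy yt].
apply: le_trans (ltW xM); rewrite ler_norml.
have := ler_norm t; have := ler_norm (- s); rewrite normrN.
have := normr_ge0 s; have := normr_ge0 t.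
by move: `|s| `|t| => a b *; apply/andP; split; lra.
Qed.

Lemma nptsE X s t w : point_process X -> X w `]s, t]%classic = (npts X s t w)%:R%:E.
Proof.
move=> /(_ w _ _ (bounded_itvoc s t)) [|n Xn]; first exact: measurable_itv.
by rewrite /npts Xn/= natrK.
Qed.

Lemma npts0 X s t w : t <= s -> npts X s t w = 0%N.
Proof.
by move=> ts; rewrite /npts set_itv_ge ?bnd_simp -?leNgt// measure0 /= truncn0.
Qed.

Lemma nptsD X s t u w : point_process X -> s <= t -> t <= u ->
  npts X s u w = (npts X s t w + npts X t u w)%N.
Proof.
move=> pX st tu; apply: (@natr_EFin_inj R).
rewrite -nptsE//.
have -> : `]s, u]%classic = `]s, t] `|` `]t, u].
  apply/seteqP; split=> x /=; rewrite !in_itv/=.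
    by move=> /andP[-> ->]; case: (lerP x t); [left|right].
  by case=> /andP[a b]; apply/andP; split=> //; [exact: le_trans b tu|exact: le_lt_trans st a].
rewrite measureU//; first by rewrite natrD EFinD -!nptsE.
apply/seteqP; split=> x //= []; rewrite !in_itv/= => /andP[_ xt] /andP[].
by rewrite ltNge xt.
Qed.

Lemma measurable_npts X s t (F : set nat) : point_process X ->
  measurable [set w | F (npts X s t w)].
Proof.
move=> pX.
rewrite (_ : mkset _ = \bigcup_(k in F) (X ^~ `]s, t]%classic) @^-1` [set k%:R%:E]).
  apply: bigcup_measurable => k _; rewrite -[X in measurable X]setTI.
  by apply: measurable_kernel => //; exact: measurable_itv.
apply/seteqP; split=> w /=.
  by move=> Fw; exists (npts X s t w) => //; exact: nptsE.
by move=> [k Fk /=]; rewrite nptsE// => /natr_EFin_inj ->.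
Qed.

End counting.

Section poisson.
Context (R : realType) (d : measure_display) (Omega : measurableType d)
  (P : probability Omega R) (r : R) (X : R.-ker Omega ~> R).
Hypotheses (r0 : 0 < r) (PX : poisson_process P r X).

Let pX : point_process X. Proof. by case: PX. Qed.

Lemma pr_npts s t k : s < t ->
  pr P [set w | npts X s t w = k] = poisson_pmf (r * (t - s)) k.
Proof.
move=> st; case: PX => _ /(_ s t k st) + _.
rewrite (_ : mkset _ = [set w | npts X s t w = k]); first by rewrite /pr => ->.
apply/seteqP; split=> w /=; rewrite nptsE//; last by move=> ->.
exact: natr_EFin_inj.
Qed.

Lemma poisson_pmf0 (x : R) : 0 < x -> poisson_pmf x 0 = expR (- x).
Proof. by move=> x0; rewrite /poisson_pmf x0 expr0 fact0 invr1 !mul1r. Qed.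

Lemma poisson_pmf1 (x : R) : 0 < x -> poisson_pmf x 1 = x * expR (- x).
Proof. by move=> x0; rewrite /poisson_pmf x0 expr1 invr1 mulr1. Qed.

Lemma pr_npts_gt0 s t : s < t ->
  pr P [set w | (0 < npts X s t w)%N] = 1 - expR (- (r * (t - s))).
Proof.
move=> st; rewrite -poisson_pmf0 ?mulr_gt0 ?subr_gt0// -pr_npts//.
rewrite -pr_setC; last exact: (measurable_npts _ _ (fun k => k = 0%N)).
by congr (pr _ _); apply/seteqP; split=> w /=; rewrite lt0n => /eqP.
Qed.

Lemma pr_npts_gt0_le s t : s <= t ->
  pr P [set w | (0 < npts X s t w)%N] <= r * (t - s).
Proof.
rewrite le_eqVlt => /predU1P[->|st].
  have -> : [set w | (0 < npts X t t w)%N] = set0.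
    by apply/seteqP; split=> w //=; rewrite npts0.
  by rewrite subrr mulr0 /pr measure0.
by rewrite pr_npts_gt0// subr_expRN_le.
Qed.

(** From [1 - (1 + x) expR (- x) <= 1 - (1 + x) (1 - x)]. *)
Lemma pr_npts_gt1_le s t : s < t ->
  pr P [set w | (1 < npts X s t w)%N] <= (r * (t - s)) ^+ 2.
Proof.
move=> st; set x := r * (t - s).
have x0 : 0 < x by rewrite mulr_gt0 ?subr_gt0.
have m k : measurable [set w | npts X s t w = k].
  exact: (measurable_npts _ _ (fun i => i = k)).
have -> : [set w | (1 < npts X s t w)%N] =
    ~` ([set w | npts X s t w = 0%N] `|` [set w | npts X s t w = 1%N]).
  apply/seteqP; split=> w /=; first by move=> + [] e; rewrite e.
  by case: (npts X s t w) => [|[|]]// []; [left|right].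
rewrite pr_setC; last exact: measurableU.
have -> : pr P ([set w | npts X s t w = 0%N] `|` [set w | npts X s t w = 1%N])
   = expR (- x) * (1 + x).
  rewrite pr_disjU//; last by apply/seteqP; split=> w //= [->].
  by rewrite !pr_npts// -/x poisson_pmf0// poisson_pmf1// mulrDr mulr1 [x * _]mulrC.
have := expR_ge1Dx (- x); nra.
Qed.

(** Chernoff's bound, obtained by tilting the rate from [r] to [r / z]. *)
Lemma pr_npts_lt_le s t z j : s < t -> 1 < z ->
  pr P [set w | (npts X s t w < j)%N] <= z ^+ j * expR (r * (t - s) * (z^-1 - 1)).
Proof.
move=> st z1; have z0 : 0 < z := lt_trans ltr01 z1.
set x := r * (t - s); have x0 : 0 < x by rewrite mulr_gt0 ?subr_gt0.
have m k : measurable [set w | npts X s t w = k].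
  exact: (measurable_npts _ _ (fun i => i = k)).
apply: (@le_trans _ _ (\sum_(k < j) pr P [set w | npts X s t w = k])).
  apply: le_trans (pr_bigsetU _ _) => //.
  rewrite le_eqVlt; apply/orP; left; apply/eqP; congr (pr _ _).
  apply/seteqP; split=> [w /= wj|w [i _ /= ->]//].
  by exists (Ordinal wj).
apply: (@le_trans _ _ (\sum_(k < j) z ^+ j * expR (x * (z^-1 - 1)) * poisson_pmf (x / z) k)).
  apply: ler_sum => k _; rewrite pr_npts// -/x.
  have zi0 : 0 < z^-1 by rewrite invr_gt0.
  have -> : poisson_pmf x k = z ^+ k * (z^-1 ^+ k * poisson_pmf x k).
    by rewrite mulrA -exprMn divff ?lt0r_neq0// expr1n mul1r.
  rewrite poisson_pmf_tilt// mulrA.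
  rewrite ler_wpM2r ?poisson_pmf_ge0// ler_wpM2r ?expR_ge0//.
  by apply: ler_weXn2l => //; [exact: ltW|exact: ltnW].
rewrite -mulr_sumr ler_piMr ?mulr_ge0 ?expR_ge0 ?exprn_ge0 ?(ltW z0)//.
have xz0 : 0 < x / z by rewrite divr_gt0.
rewrite -lee_fin -(sum_poisson_pmf xz0) -sumEFin
  -(big_mkord xpredT (fun k => (poisson_pmf (x / z) k)%:E)).
apply: nneseries_lim_ge => k _ _; exact: poisson_pmf_ge0.
Qed.

End poisson.

(** * Events determined by a process *)

Section sigma_process.
Context (R : realType) (d : measure_display) (Omega : measurableType d).
Implicit Types (X Y : R.-ker Omega ~> R).

Lemma sigma_process_measurable X E : sigma_process X E -> measurable E.
Proof.
apply: smallest_sub => [|F [B [C [mB mC ->]]]]; first exact: sigma_algebra_measurable.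
by rewrite -[X in measurable X]setTI; exact: measurable_kernel.
Qed.

Lemma sigma_process_npts X s t (F : set nat) : point_process X ->
  sigma_process X [set w | F (npts X s t w)].
Proof.
move=> pX; apply: sub_gen_smallest.
exists `]s, t]%classic, (\bigcup_(k in F) [set k%:R%:E]); split.
- exact: measurable_itv.
- by apply: bigcup_measurable => k _.
- apply/seteqP; split=> w /=; rewrite nptsE//.
    by move=> Fw; exists (npts X s t w).
  by move=> [k Fk /=] /natr_EFin_inj ->.
Qed.

Lemma sigma_process_bigcap X (I : finType) (F : I -> set Omega) :
  (forall i, sigma_process X (F i)) -> sigma_process X (\bigcap_i F i).
Proof.
move=> mF; have := @fin_bigcap_measurable _ (g_sigma_algebraType
 [set E | exists B : set R, exists C : set (\bar R),
         [/\ measurable B, measurable C & E = (X ^~ B) @^-1` C]]) I setT F.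
by apply=> [|i _]; [exact: finite_finset|exact: mF].
Qed.

Lemma pr_independent (P : probability Omega R) X Y E F :
  independent_processes P X Y -> sigma_process X E -> sigma_process Y F ->
  pr P (E `&` F) = pr P E * pr P F.
Proof.
move=> iXY sE sF; apply: EFin_inj; rewrite EFinM -!prE.
- exact: iXY.
- exact: (sigma_process_measurable sF).
- exact: (sigma_process_measurable sE).
- by apply: measurableI; [exact: (sigma_process_measurable sE)|
    exact: (sigma_process_measurable sF)].
Qed.

End sigma_process.

(** * Services outnumber arrivals in the remote past *)

Section overload.
Context (R : realType) (d : measure_display) (Omega : measurableType d)
  (A S : R.-ker Omega ~> R).
Hypotheses (pA : point_process A) (pS : point_process S).

(** One more unit of time is granted to the arrivals than to the services, so
    that the event controls all starting times in [[t0 - m.+1, t0 - m]]. *)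
Definition overload (t0 : R) (K m : nat) : set Omega :=
  [set w | (npts S (t0 - m%:R) t0 w < npts A (t0 - m.+1%:R) t0 w + K)%N].

Lemma measurable_overload t0 K m : measurable (overload t0 K m).
Proof.
rewrite (_ : overload _ _ _ = \bigcup_k
  ([set w | npts A (t0 - m.+1%:R) t0 w = k] `&`
   [set w | (npts S (t0 - m%:R) t0 w < k + K)%N])).
  apply: bigcup_measurable => k _; apply: measurableI.
    exact: (measurable_npts _ _ (fun i => i = k)).
  exact: (measurable_npts _ _ (fun i => (i < k + K)%N)).
apply/seteqP; split=> w /=; first by move=> ?; exists (npts A (t0 - m.+1%:R) t0 w).
by move=> [k _ [/= <-]].
Qed.

Lemma emptied_after t0 K M w :
  ~ (\bigcup_(m in [set m | (M <= m)%N]) overload t0 K m) w ->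
  forall s, s <= t0 - M%:R -> (npts A s t0 w + K <= npts S s t0 w)%N.
Proof.
move=> ov s sM.
have st0 : M%:R <= t0 - s by rewrite lerBrDl -lerBrDr.
have ts0 : 0 <= t0 - s by rewrite (le_trans _ st0).
pose m := Num.truncn (t0 - s).
have Mm : (M <= m)%N by rewrite truncn_ge_nat.
have /andP[m1 m2] := truncn_itv ts0; rewrite -/m in m1 m2.
have sm1 : t0 - m.+1%:R <= s by rewrite lerBlDr -lerBlDl ltW.
have sm2 : s <= t0 - m%:R by rewrite lerBrDr -lerBrDl.
have st : s <= t0 by rewrite -subr_ge0.
have tm : t0 - m%:R <= t0 by rewrite gerBl.
have := nptsD w pA sm1 st; have := nptsD w pS sm2 tm.
have : ~ overload t0 K m w by move=> ?; apply: ov; exists m.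
by rewrite /overload /= => /negP; rewrite -leqNgt; lia.
Qed.

End overload.

Section drift.
Context (R : realType) (d : measure_display) (Omega : measurableType d)
  (P : probability Omega R) (lambda mu : R) (A S : R.-ker Omega ~> R).
Hypotheses (lambda0 : 0 < lambda) (lambda_mu : lambda < mu)
  (PA : poisson_process P lambda A) (PS : poisson_process P mu S)
  (AS : independent_processes P A S).

Let pA : point_process A. Proof. by case: PA. Qed.
Let pS : point_process S. Proof. by case: PS. Qed.
Let mu0 : 0 < mu. Proof. exact: lt_trans lambda0 lambda_mu. Qed.

(* Any value between 1 and [mu / lambda] makes the Chernoff exponent negative. *)
Let z : R := (1 + mu / lambda) / 2.

Let z1 : 1 < z.
Proof. by rewrite /z; have : 1 < mu / lambda; [rewrite ltr_pdivlMr ?mul1r|lra]. Qed.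

Let z0 : 0 < z. Proof. exact: lt_trans ltr01 z1. Qed.

Let decay : R := expR (lambda * (z - 1) + mu * (z^-1 - 1)).

Let decay0 : 0 <= decay. Proof. exact: expR_ge0. Qed.

Let decay1 : decay < 1.
Proof.
rewrite /decay expR_lt1.
have zmu : lambda * z < mu.
  have -> : lambda * z = (lambda + mu) / 2.
    by rewrite /z; field; rewrite lt0r_neq0.
  by move: lambda_mu; move: (lambda) (mu) => a b ?; lra.
rewrite -(pmulr_rlt0 _ z0).
have -> : z * (lambda * (z - 1) + mu * (z^-1 - 1)) = (z - 1) * (lambda * z - mu).
  by field; rewrite lt0r_neq0.
by rewrite pmulr_rlt0 ?subr_lt0 ?subr_gt0.
Qed.

(** Chernoff's bound for [A - S], summing over the number of arrivals. *)
Lemma pr_overload t0 K m : (0 < m)%N ->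
  pr P (overload A S t0 K m) <= z ^+ K * expR (lambda * (z - 1)) * decay ^+ m.
Proof.
move=> m0; rewrite -lee_fin -prE; last exact: measurable_overload.
have tm0 : t0 - m%:R < t0 by rewrite gtrBl ltr0n.
have tm1 : t0 - m.+1%:R < t0 by rewrite gtrBl ltr0n.
pose F k := [set w | npts A (t0 - m.+1%:R) t0 w = k] `&`
   [set w | (npts S (t0 - m%:R) t0 w < k + K)%N].
have mF k : measurable (F k).
  apply: measurableI.
    exact: (measurable_npts _ _ (fun i => i = k)).
  exact: (measurable_npts _ _ (fun i => (i < k + K)%N)).
apply: (@le_trans _ _ (\sum_(k <oo) P (F k))%E).
  apply: measure_sigma_subadditive => //; first exact: measurable_overload.
  by move=> w /= ?; exists (npts A (t0 - m.+1%:R) t0 w).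
set a := lambda * m.+1%:R; have a0 : 0 < a by rewrite mulr_gt0.
set b := mu * m%:R.
pose c := z ^+ K * expR (b * (z^-1 - 1)) * expR (a * (z - 1)).
have -> : z ^+ K * expR (lambda * (z - 1)) * decay ^+ m = c.
  rewrite /c /decay -expRM_natl -!mulrA -!expRD; congr (_ * expR _).
  by rewrite /a /b -natr1; ring.
apply: (@le_trans _ _ (\sum_(k <oo) (c%:E * (poisson_pmf (a * z) k)%:E))%E); last first.
  rewrite nneseriesZl; last by move=> k _; exact: poisson_pmf_ge0.
  by rewrite sum_poisson_pmf ?mule1// mulr_gt0.
apply: lee_nneseries => k _ => //.
rewrite prE// -EFinM lee_fin (pr_independent AS); last 2 first.
  exact: (sigma_process_npts _ _ (fun i => i = k)).
  exact: (sigma_process_npts _ _ (fun i => (i < k + K)%N)).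
rewrite (pr_npts PA)// opprB addrCA subrr addr0 -/a.
have := pr_npts_lt_le mu0 PS (k + K) tm0 z1.
rewrite opprB addrCA subrr addr0 -/b => h.
apply: (le_trans (ler_wpM2l (poisson_pmf_ge0 _ _) h)).
rewrite exprD [leLHS](_ : _ =
  z ^+ K * expR (b * (z^-1 - 1)) * (z ^+ k * poisson_pmf a k)); last by ring.
by rewrite poisson_pmf_tilt// mulrA.
Qed.

(** The bounds of [pr_overload] are summable. *)
Lemma pr_overload_tail t0 K (eps : R) : 0 < eps ->
  exists M, pr P (\bigcup_(m in [set m | (M <= m)%N]) overload A S t0 K m) <= eps.
Proof.
move=> eps0; pose c := z ^+ K * expR (lambda * (z - 1)).
have c0 : 0 <= c by rewrite mulr_ge0 ?expR_ge0// exprn_ge0// ltW.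
pose u m := (c * decay ^+ m)%:E.
have u0 m : (0 <= u m)%E by rewrite lee_fin mulr_ge0// exprn_ge0.
have cu : (\sum_(m <oo) u m < +oo)%E.
  apply: (@le_lt_trans _ _ (c * (1 - decay)^-1)%:E); last exact: ltry.
  apply: lime_le; first exact: is_cvg_nneseries.
  apply: nearW => n /=; rewrite sumEFin lee_fin -mulr_sumr ler_wpM2l//.
  rewrite -[leRHS]mul1r ler_pdivlMr ?subr_gt0// mulrC big_mkord geometric_mass.
  by rewrite gerBl exprn_ge0.
have := nneseries_tail_cvg cu (fun m _ => u0 m).
move=> /fine_cvgP[fin /cvgrPdist_le /(_ _ eps0)] H.
near \oo => M; exists M.
have mov m : measurable (overload A S t0 K m) by exact: measurable_overload.
have mU : measurable (\bigcup_(m in [set m | (M <= m)%N]) overload A S t0 K m).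
  exact: bigcup_measurable.
rewrite -lee_fin -prE//.
have M0 : (0 < M)%N by near: M; exists 1%N.
apply: (@le_trans _ _ (\sum_(M <= m <oo) P (overload A S t0 K m))%E).
  apply: measure_sigma_subadditive_tail => //.
  by move=> w [m Mm ?]; exists m => //=; apply/negP; rewrite -leqNgt.
apply: (@le_trans _ _ (\sum_(M <= m <oo) u m)%E).
  rewrite [leLHS]eseries_cond [leRHS]eseries_cond; apply: lee_nneseries => // m /andP[_ Mm].
  by rewrite prE// lee_fin /u; apply: pr_overload; exact: leq_trans Mm.
rewrite -[leLHS]fineK; last by near: M.
rewrite lee_fin (le_trans (ler_norm _))//.
near: M; apply: filterS H => M; rewrite sub0r normrN; exact.
Unshelve. all: by end_near.
Qed.

End drift.

(** * Sampling the queue on a grid *)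

Section sampled_queue.
Context (R : realType) (al si : R -> R -> nat).
Hypothesis alD : forall s t u, s <= t -> t <= u -> al s u = (al s t + al t u)%N.
Hypothesis siD : forall s t u, s <= t -> t <= u -> si s u = (si s t + si t u)%N.

(** The supremum that defines the queue length, restricted to starting times
    after [b], is the length at [t] of the queue that is empty at [b]. *)
Definition queue_since (b t : R) (q : nat) :=
  (forall s, b <= s -> s <= t -> (al s t <= si s t + q)%N) /\
  (exists s, [/\ b <= s, s <= t & al s t = (si s t + q)%N]).

Let al0 s : al s s = 0%N.
Proof. by have := alD (lexx s) (lexx s); lia. Qed.
Let si0 s : si s s = 0%N.
Proof. by have := siD (lexx s) (lexx s); lia. Qed.

Lemma queue_since_start b : queue_since b b 0.
Proof.
split=> [s bs sb|]; last by exists b; split; rewrite ?al0 ?si0.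
have -> : s = b by apply/eqP; rewrite eq_le bs sb.
by rewrite al0 si0.

Qed.

(** Over a cell holding at most one point, the supremum is attained at an end of
    the cell. *)
Lemma queue_since_step b g g' q (x : bool * bool) : b <= g -> g <= g' ->
  al g g' = x.1 -> si g g' = x.2 -> ~~ (x.1 && x.2) ->
  queue_since b g q -> queue_since b g' (qstep q x).
Proof.
case: x => [x y] /= bg gg' alx six xy [H1 [s0 [bs0 s0g e0]]].
rewrite /qstep /=; split.
  move=> s bs sg'; have [sg|gs] := lerP s g.
    have := alD sg gg'; have := siD sg gg'; have := H1 _ bs sg.
    by lia.
  have := alD (ltW gs) sg'; rewrite alx => h.
  by move: alx six xy h; case: x; case: y => //=; lia.
have := alD s0g gg'; have := siD s0g gg'; rewrite e0 alx six => h1 h2.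
have [h|h] := leqP y (q + x).
  by exists s0; split=> //; [exact: le_trans s0g gg'|move: h h1 h2; lia].
exists g'; split=> //; first exact: le_trans bg gg'.
by rewrite al0 si0; lia.
Qed.

Variables (b h : R) (N : nat).
Hypothesis h0 : 0 < h.

Definition grid (k : nat) : R := b + k%:R * h.

Lemma le_grid i j : (i <= j)%N -> grid i <= grid j.
Proof. by move=> ij; rewrite lerD2l ler_pM2r// ler_nat. Qed.

Definition bits : seq (bool * bool) :=
  mkseq (fun k => (0 < al (grid k) (grid k.+1), 0 < si (grid k) (grid k.+1))%N) N.

Lemma size_bits : size bits = N. Proof. exact: size_mkseq. Qed.

Hypothesis sparse : forall k, (k < N)%N ->
  (al (grid k) (grid k.+1) + si (grid k) (grid k.+1) <= 1)%N.

Definition segment (i j : nat) T (l : seq T) : seq T := drop i (take j l).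

Lemma segmentS i j (T : Type) (x0 : T) (l : seq T) : (i <= j)%N -> (j < size l)%N ->
  segment i j.+1 l = rcons (segment i j l) (nth x0 l j).
Proof.
move=> ij jl; rewrite /segment (take_nth x0)// drop_rcons//.
by rewrite size_take jl.
Qed.

Lemma segment_counts i j : (i <= j)%N -> (j <= N)%N ->
  al (grid i) (grid j) = arrivals (segment i j bits) /\
  si (grid i) (grid j) = services (segment i j bits).
Proof.
move=> + jN; elim: j jN => [|j IH] jN.
  by rewrite leqn0 => /eqP ->; rewrite al0 si0 /segment take0 /arrivals /services !big_nil.
rewrite leq_eqVlt => /predU1P[->|ij].
  rewrite al0 si0 /segment drop_oversize ?size_take ?size_bits; last by case: ifP => //; lia.
  by rewrite /arrivals /services !big_nil.
rewrite ltnS in ij.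
have [e1 e2] := IH (ltnW jN) ij.
rewrite (alD (le_grid ij) (le_grid (leqnSn j))) (siD (le_grid ij) (le_grid (leqnSn j))).
rewrite (segmentS (false,false)) ?size_bits// /arrivals /services -!cats1 !big_cat /=.
rewrite -/(arrivals _) -/(services _) -e1 -e2 !big_seq1 nth_mkseq//=.
have := sparse jN; move: (al (grid j) _) (si (grid j) _) => [|[|]] // [|[|]] //; lia.
Qed.

Lemma queue_since_grid k : (k <= N)%N -> queue_since b (grid k) (qrun 0 (take k bits)).
Proof.
elim: k => [|k IH] kN.
  by rewrite take0 /grid mul0r addr0; exact: queue_since_start.
rewrite (take_nth (false, false)) ?size_bits// -cats1 qrun_cat.
have := sparse kN => sp.
apply: (queue_since_step (g := grid k)).
- by rewrite -[leLHS]addr0 lerD2l mulr_ge0// ltW.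
- exact: le_grid.
- rewrite nth_mkseq//=; move: sp; move: (al (grid k) _) => [|[|]]//; lia.
- rewrite nth_mkseq//=; move: sp; move: (si (grid k) _) => [|[|]]//; lia.
- by rewrite nth_mkseq//=; apply/negP; lia.
- exact/IH/ltnW.
Qed.

End sampled_queue.

Lemma segment_drop (T : Type) m i j (l : seq T) : (m <= i)%N -> (m <= j)%N ->
  segment i j l = segment (i - m) (j - m) (drop m l).
Proof. by move=> mi mj; rewrite /segment take_drop subnK// drop_drop subnK. Qed.

Lemma segment_orun i j l : (i <= j)%N ->
  segment i j (orun 0 l) = orun (qrun 0 (take i l)) (segment i j l).
Proof. by move=> ij; rewrite /segment take_orun orun_drop take_takel. Qed.

Lemma qrun_segment i j l : (i <= j)%N ->
  qrun (qrun 0 (take i l)) (segment i j l) = qrun 0 (take j l).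
Proof. by move=> ij; rewrite -qrun_cat /segment -(take_takel l ij) cat_take_drop. Qed.

Definition count_marks (k : bool) (l : seq (bool * bool)) : nat :=
  if k then arrivals l else services l.

Section grid_index.
Context (R : realType) (b h : R).
Hypothesis h0 : 0 < h.

Definition round_up (u : R) : nat := `|Num.ceil ((u - b) / h)|%N.

Lemma round_upP u : b <= u ->
  u <= grid b h (round_up u) /\ grid b h (round_up u) <= u + h.
Proof.
move=> bu; have ub0 : 0 <= (u - b) / h by rewrite divr_ge0 ?subr_ge0// ltW.
have cE : (round_up u)%:R = (Num.ceil ((u - b) / h))%:~R :> R.
  by rewrite /round_up natr_absz ger0_norm// ceil_ge0// (lt_le_trans _ ub0)// ltrN10.
have := ceil_itv ((u - b) / h); rewrite intrB -cE => /andP[lo hi].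
have ue : u = b + (u - b) / h * h by rewrite divfK ?lt0r_neq0// subrKC.
rewrite /grid; move: lo hi ue; set x := (u - b) / h; move: (_%:R) => c lo hi ->.
rewrite -addrA !lerD2l -[X in _ /\ _ <= _ + X]mul1r -mulrDl !ler_pM2r//; split=> //.
by rewrite -lerBlDr ltW.
Qed.

Lemma le_round_up u v : b <= u -> u <= v -> (round_up u <= round_up v)%N.
Proof.
move=> bu uv; rewrite -(ler_nat R) /round_up !natr_absz !ger0_norm.
- by rewrite ler_int le_ceil// ler_pM2r ?invr_gt0// lerD2r.
- by rewrite ceil_ge0 (@lt_le_trans _ _ 0)// divr_ge0 ?(ltW h0)// subr_ge0 (le_trans bu).
- by rewrite ceil_ge0 (@lt_le_trans _ _ 0)// divr_ge0 ?(ltW h0)// subr_ge0.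
Qed.

Lemma round_up_grid k : round_up (grid b h k) = k.
Proof.
rewrite /round_up /grid addrC addKr mulfK ?lt0r_neq0//.
by rewrite (@ceil_def _ _ k%:Z)// pmulrn lexx andbT ltr_int gtrBl.
Qed.

End grid_index.

(** Rounding both endpoints does not change the count of an interval when
    it jumps over no point. *)
Lemma additive_shift (R : realType) (f : R -> R -> nat) (s s' t t' : R) :
  (forall x y z, x <= y -> y <= z -> f x z = (f x y + f y z)%N) ->
  s <= s' -> t <= t' -> s <= t -> s' <= t' -> f s s' = 0%N -> f t t' = 0%N ->
  f s t = f s' t'.
Proof.
move=> fD ss' tt' st st' f0 f0'.
by have := fD _ _ _ st tt'; rewrite (fD _ _ _ ss' st') f0 f0'; lia.
Qed.

(** * Outputs of a sample path as functions of the bits *)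

Section sample_path.
Context (R : realType) (d : measure_display) (Omega : measurableType d)
  (A S : R.-ker Omega ~> R) (w : Omega).
Hypotheses (pA : point_process A) (pS : point_process S).
Let al s t := npts A s t w.
Let si s t := npts S s t w.
Let alD s t u : s <= t -> t <= u -> al s u = (al s t + al t u)%N.
Proof. exact: nptsD. Qed.
Let siD s t u : s <= t -> t <= u -> si s u = (si s t + si t u)%N.
Proof. exact: nptsD. Qed.

Lemma queue_lengthE t (q : nat) :
  (forall s, s <= t -> (al s t <= si s t + q)%N) ->
  (exists2 s, s <= t & al s t = (si s t + q)%N) ->
  queue_length A S w t = q%:R%:E.
Proof.
move=> H1 [s st e]; rewrite /queue_length; apply/eqP; rewrite eq_le; apply/andP; split.
  apply: ge_ereal_sup => _ [r /= rt <-]; rewrite !nptsE// -EFinB ge_max !lee_fin ler0n andbT.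
  by rewrite lerBlDl -natrD ler_nat; exact: H1.
apply: ereal_sup_ubound; exists s => //.
rewrite !nptsE// -EFinB -/(al s t) -/(si s t) e natrD [X in X%:E]addrC addKr.
by apply/max_idPl; rewrite lee_fin ler0n.
Qed.

(** Starting times before [b] do not contribute to the supremum when they do not
    at time [t0]. *)
Lemma queue_length_since b t0 t q : b <= t0 -> t0 <= t ->
  (forall s, s <= b -> (al s t0 <= si s t0)%N) ->
  queue_since al si b t q -> queue_length A S w t = q%:R%:E.
Proof.
move=> bt0 t0t fine [H1 [s0 [bs0 s0t e]]]; apply: queue_lengthE; last by exists s0.
move=> s st; have [bs|sb] := lerP b s; first exact: H1.
have st0 : s <= t0 := le_trans (ltW sb) bt0.
by rewrite (alD st0 t0t) (siD st0 t0t) -addnA leq_add// ?fine ?(ltW sb)// H1.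
Qed.

Variables (D U T : R.-ker Omega ~> R).
Hypotheses (pD : point_process D) (pU : point_process U) (pT : point_process T).
Hypothesis departures : forall s t : R, s < t -> D w `]s, t]%classic =
  (A w `]s, t]%classic + queue_length A S w s - queue_length A S w t)%E.
Hypothesis unused : forall B : set R, measurable B -> bounded_set B ->
  U w B = (S w B - D w B)%E.
Hypothesis total : forall B : set R, measurable B -> T w B = (A w B + U w B)%E.

Let npts_U s t : (npts U s t w + npts D s t w = npts S s t w)%N.
Proof.
apply: (@natr_EFin_inj R); have := unused (measurable_itv `]s, t]) (bounded_itvoc s t).
rewrite !nptsE// -EFinB => -[e]; congr EFin.
by rewrite natrD e subrK.
Qed.

Let npts_T s t : (npts T s t w + npts D s t w = npts A s t w + npts S s t w)%N.
Proof.
have : npts T s t w = (npts A s t w + npts U s t w)%N.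
  apply: (@natr_EFin_inj R); have := total (measurable_itv `]s, t]).
  by rewrite !nptsE// -EFinD => -[e]; congr EFin; rewrite natrD.
by move=> ->; rewrite -addnA npts_U.
Qed.

Variables (b h : R) (N m0 K : nat).
Hypothesis h0 : 0 < h.
Hypothesis sparse : forall k, (k < N)%N ->
  (al (grid b h k) (grid b h k.+1) + si (grid b h k) (grid b h k.+1) <= 1)%N.
Hypothesis m0N : (m0 <= N)%N.
Hypothesis emptied : forall s, s <= b ->
  (al s (grid b h m0) + K <= si s (grid b h m0))%N.

Let l := bits al si b h N.

Let b_m0 : b <= grid b h m0.
Proof. by rewrite -[leLHS]addr0 lerD2l mulr_ge0// ltW. Qed.

Let q_at k := qrun 0 (take k l).

Let queue_grid k : (m0 <= k)%N -> (k <= N)%N ->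
  queue_length A S w (grid b h k) = (q_at k)%:R%:E.
Proof.
move=> mk kN; apply: (queue_length_since b_m0) => //.
- exact: le_grid.
- by move=> s sb; apply: leq_trans (emptied sb); rewrite leq_addr.
- exact: queue_since_grid.
Qed.

(** On the grid the departures are [A(s,t] + Q(s) - Q(t)] in discrete and in continuous
    time, with the same queue lengths, and [T = A + S - D]. *)
Lemma in_out_grid i j k : (m0 <= i)%N -> (i <= j)%N -> (j <= N)%N ->
  npts (if k then A else S) (grid b h i) (grid b h j) w = count_marks k (segment i j l) /\
  npts (if k then D else T) (grid b h i) (grid b h j) w =
    count_marks k (segment i j (orun 0 l)).
Proof.
move=> mi ij jN.
have [eA eS] := segment_counts alD siD h0 sparse ij jN; rewrite -/l in eA eS.
have eD : npts D (grid b h i) (grid b h j) w = arrivals (segment i j (orun 0 l)).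
  have := arrivals_orun (q_at i) (segment i j l).
  rewrite -segment_orun// qrun_segment// -/(q_at j) -eA => e.
  apply/eqP; rewrite -(eqn_add2r (q_at j)) e; apply/eqP.
  move: ij; rewrite leq_eqVlt => /predU1P[->|ij].
    by rewrite /al !npts0// addnC.
  have gij : grid b h i < grid b h j by rewrite ltrD2l ltr_pM2r// ltr_nat.
  apply: (@natr_EFin_inj R); have := departures gij.
  rewrite !nptsE// !queue_grid// ?(leq_trans (ltnW ij))// ?(leq_trans mi (ltnW ij))//.
  rewrite -EFinD => -[e']; congr EFin.
  by rewrite !natrD e' subrK addrC.
have eT : npts T (grid b h i) (grid b h j) w = services (segment i j (orun 0 l)).
  have := npts_T (grid b h i) (grid b h j).
  have := services_orun (q_at i) (segment i j l).
  rewrite -segment_orun// -eD -eA -eS /al /si; lia.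
by case: k.
Qed.

(** Services outnumber arrivals by [K] before the time [grid b h m0], hence empty
    every queue that starts at [b] with at most [K] customers. *)
Lemma orun_merge q i j : (q <= K)%N -> (m0 <= i)%N -> (m0 <= j)%N ->
  segment i j (orun q l) = segment i j (orun 0 l).
Proof.
move=> qK mi mj; rewrite !(segment_drop _ mi mj) !orun_drop; congr segment.
congr orun; apply: qrun_coupling.
have [e1 e2] := segment_counts alD siD h0 sparse (leq0n m0) m0N.
move: e1 e2; rewrite /segment !drop0 /grid mul0r addr0 -/(grid b h m0) -/l => <- <-.
by have := emptied (lexx b); lia.
Qed.

(** Points of D and T lie among those of A and S, so the gaps between endpoints
    and grid carry no output either. *)
Lemma in_out_npts s t k : grid b h m0 <= s -> grid b h m0 <= t ->
  s + h <= grid b h N -> t + h <= grid b h N ->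
  al s (grid b h (round_up b h s)) = 0%N -> al t (grid b h (round_up b h t)) = 0%N ->
  si s (grid b h (round_up b h s)) = 0%N -> si t (grid b h (round_up b h t)) = 0%N ->
  npts (if k then A else S) s t w = count_marks k (segment (round_up b h s) (round_up b h t) l) /\
  npts (if k then D else T) s t w =
    count_marks k (segment (round_up b h s) (round_up b h t) (orun 0 l)).
Proof.
set i := round_up b h s; set j := round_up b h t => ms mt sN tN as0 at0 ss0 st0.
have bs : b <= s := le_trans b_m0 ms; have bt : b <= t := le_trans b_m0 mt.
have [si1 si2] := round_upP h0 bs; have [ti1 ti2] := round_upP h0 bt.
have [ts|st] := lerP t s.
  have ji : (j <= i)%N by exact: le_round_up.
  rewrite !npts0// /segment !drop_oversize ?size_take_min ?geq_min ?ji//.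
  by rewrite /count_marks /arrivals /services !big_nil if_same.
have ij : (i <= j)%N := le_round_up h0 bs (ltW st).
have mi : (m0 <= i)%N by rewrite -(round_up_grid b h0 m0); exact: le_round_up.
have jN : (j <= N)%N.
  have : grid b h j <= grid b h N by exact: le_trans tN.
  by rewrite lerD2l ler_pM2r// ler_nat.
have [<- <-] := in_out_grid k mi ij jN.
have nD u v : npts S u v w = 0%N -> npts D u v w = 0%N.
  by move=> s0; have /eqP := npts_U u v; rewrite s0 addn_eq0 => /andP[_ /eqP].
have nT u v : npts A u v w = 0%N -> npts S u v w = 0%N -> npts T u v w = 0%N.
  move=> a0 s0; have /eqP := npts_T u v.
  by rewrite a0 s0 addn_eq0 => /andP[/eqP].
by case: k; split; apply: (additive_shift (f := fun x y => npts _ x y w)) => //;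
  rewrite ?(ltW st) ?le_grid//; (try by move=> *; exact: nptsD);
  solve [exact: nD|exact: nT].
Qed.

End sample_path.

(** * The law of the input bits *)

Section increments.
Context (R : realType) (d : measure_display) (Omega : measurableType d)
  (P : probability Omega R) (r : R) (X : R.-ker Omega ~> R).
Hypotheses (r0 : 0 < r) (PX : poisson_process P r X).
Let pX : point_process X. Proof. by case: PX. Qed.

Lemma pr_npts_mutual (n : nat) (s t : 'I_n -> R) (F : 'I_n -> set nat) :
  (forall i, s i < t i) -> trivIset setT (fun i => `]s i, t i]%classic) ->
  pr P (\bigcap_i [set w | F i (npts X (s i) (t i) w)]) =
  \prod_(i < n) pr P [set w | F i (npts X (s i) (t i) w)].
Proof.
move=> st triv; case: PX => _ _ /(_ n s t st triv).
pose C i : set (\bar R) := \bigcup_(k in F i) [set k%:R%:E].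
have CE i w : C i (X w `]s i, t i]%classic) = F i (npts X (s i) (t i) w).
  apply/propext; rewrite nptsE//; split; last by move=> ?; exists (npts X (s i) (t i) w).
  by move=> [k Fk /natr_EFin_inj ->].
move=> /(_ C) H; apply: EFin_inj.
have mF i : measurable [set w | F i (npts X (s i) (t i) w)].
  by apply: (measurable_npts _ _ (F i)).
rewrite -prE; last by apply: fin_bigcap_measurable => // ; exact: finite_finset.
rewrite -prodEFin -(_ : P [set w | forall i, C i (X w `]s i, t i]%classic)] =
  P (\bigcap_i [set w | F i (npts X (s i) (t i) w)])).
  rewrite H => [|i]; last by apply: bigcup_measurable => k _.
  apply: eq_bigr => i _; rewrite -prE//; congr (P _).
  by apply/seteqP; split=> w /=; rewrite CE.
congr (P _); apply/seteqP; split=> w /=.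
  by move=> H' i _ /=; rewrite -CE.
by move=> H' i; rewrite CE; exact: H'.
Qed.

Lemma pr_cells (b h : R) (N : nat) (bs : nat -> bool) : 0 < h ->
  pr P (\bigcap_(k : 'I_N)
    [set w | (0 < npts X (grid b h k) (grid b h k.+1) w)%N = bs k]) =
  \prod_(k < N) bern (1 - expR (- (r * h))) (bs k).
Proof.
move=> h0.
have cell k : grid b h k < grid b h k.+1 by rewrite ltrD2l ltr_pM2r// ltr_nat.
rewrite (@pr_npts_mutual N (fun k => grid b h k) (fun k => grid b h k.+1)
  (fun k m => (0 < m)%N = bs k)) => [|//|]; last first.
  move=> i j _ _ [x [/=]]; rewrite !in_itv/= => /andP[ix xi] /andP[jx xj].
  apply/val_inj/eqP; rewrite eqn_leq; apply/andP; split; rewrite leqNgt; apply/negP => ij.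
    by have := lt_le_trans ix (le_trans xj (le_grid b h0 ij)); rewrite ltxx.
  by have := lt_le_trans jx (le_trans xi (le_grid b h0 ij)); rewrite ltxx.
apply: eq_bigr => k _; have := pr_npts_gt0 r0 PX (cell k).
rewrite (_ : grid b h k.+1 - grid b h k = h); last by rewrite /grid -natr1; ring.
case: (bs k) => /= [<-|e]; first by congr (pr _ _); apply/seteqP; split.
rewrite -e -pr_setC; last exact: (measurable_npts _ _ (fun m => (0 < m)%N)).
by congr (pr _ _); apply/seteqP; split=> w /=; [move=> ->|move/negP/negbTE].
Qed.

End increments.

Section input_bits.
Context (R : realType) (d : measure_display) (Omega : measurableType d)
  (A S : R.-ker Omega ~> R) (b h : R) (N : nat).
Hypotheses (pA : point_process A) (pS : point_process S).

Definition input_bits (w : Omega) : seq (bool * bool) :=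
  bits (fun s t => npts A s t w) (fun s t => npts S s t w) b h N.

Definition cell_bits (X : R.-ker Omega ~> R) (bs : nat -> bool) : set Omega :=
  \bigcap_(k : 'I_N) [set w | (0 < npts X (grid b h k) (grid b h k.+1) w)%N = bs k].

Lemma input_bitsE (l : seq (bool * bool)) : size l = N -> [set w | input_bits w = l] =
  cell_bits A (fun k => (nth (false, false) l k).1) `&`
  cell_bits S (fun k => (nth (false, false) l k).2).
Proof.
move=> lN; apply/seteqP; split=> w /=.
  by move=> <-; split=> k _ /=; rewrite nth_mkseq.
move=> [cA cS]; apply: (@eq_from_nth _ (false, false)); rewrite size_bits ?lN// => k kN.
rewrite nth_mkseq//; have /= -> := cA (Ordinal kN) I; have /= -> := cS (Ordinal kN) I.
by case: (nth _ _ _).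
Qed.

Lemma sigma_process_cell_bits X bs : point_process X ->
  sigma_process X (cell_bits X bs).
Proof.
move=> pX; apply: sigma_process_bigcap => k.
exact: (sigma_process_npts _ _ (fun m => (0 < m)%N = bs k)).
Qed.

Lemma measurable_input_bits l : size l = N -> measurable [set w | input_bits w = l].
Proof.
move=> lN; rewrite input_bitsE//; apply: measurableI;
  [apply: (@sigma_process_measurable _ _ _ A)|apply: (@sigma_process_measurable _ _ _ S)];
  exact: sigma_process_cell_bits.
Qed.

Definition crowded : set Omega := \bigcup_(k : 'I_N)
  [set w | (1 < npts A (grid b h k) (grid b h k.+1) w + npts S (grid b h k) (grid b h k.+1) w)%N].

Lemma measurable_crowded : measurable crowded.
Proof.
apply: fin_bigcup_measurable => [|k _]; first exact: finite_finset.
rewrite (_ : mkset _ = \bigcup_m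
  ([set w | npts A (grid b h k) (grid b h k.+1) w = m] `&`
   [set w | (1 < m + npts S (grid b h k) (grid b h k.+1) w)%N])).
  apply: bigcup_measurable => m _; apply: measurableI.
    exact: (measurable_npts _ _ (fun i => i = m)).
  exact: (measurable_npts _ _ (fun i => (1 < m + i)%N)).
apply/seteqP; split=> w /=; first by move=> ?; exists (npts A (grid b h k) (grid b h k.+1) w).
by move=> [m _ [/= <-]].
Qed.

End input_bits.

Section input_bits_law.
Context (R : realType) (d : measure_display) (Omega : measurableType d)
  (P : probability Omega R) (lambda mu : R) (A S : R.-ker Omega ~> R).
Hypotheses (lambda0 : 0 < lambda) (mu0 : 0 < mu)
  (PA : poisson_process P lambda A) (PS : poisson_process P mu S)
  (AS : independent_processes P A S).
Let pA : point_process A. Proof. by case: PA. Qed.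
Let pS : point_process S. Proof. by case: PS. Qed.
Variables (b h : R) (N : nat).
Hypothesis h0 : 0 < h.

Lemma pr_input_bits l : size l = N -> pr P [set w | input_bits A S b h N w = l] =
  \prod_(x <- l) wgt (1 - expR (- (lambda * h))) (1 - expR (- (mu * h))) x.
Proof.
move=> lN; rewrite input_bitsE// (pr_independent AS); [|exact: sigma_process_cell_bits..].
rewrite (pr_cells lambda0 PA)// (pr_cells mu0 PS)// -big_split/=.
by rewrite (big_nth (false, false)) lN big_mkord.
Qed.

(** A cell is crowded with probability of order [h ^+ 2]. *)
Lemma pr_crowded : pr P (crowded A S b h N) <= N%:R * ((lambda + mu) * h) ^+ 2.
Proof.
have cell k : grid b h k < grid b h k.+1 by rewrite ltrD2l ltr_pM2r// ltr_nat.
have cellE k : grid b h k.+1 - grid b h k = h by rewrite /grid -natr1; ring.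
pose G (k : nat) := [set w | (1 < npts A (grid b h k) (grid b h k.+1) w +
   npts S (grid b h k) (grid b h k.+1) w)%N].
pose a (k : nat) := [set w | (1 < npts A (grid b h k) (grid b h k.+1) w)%N].
pose s (k : nat) := [set w | (1 < npts S (grid b h k) (grid b h k.+1) w)%N].
pose a' (k : nat) := [set w | (0 < npts A (grid b h k) (grid b h k.+1) w)%N].
pose s' (k : nat) := [set w | (0 < npts S (grid b h k) (grid b h k.+1) w)%N].
have ma k : measurable (a k) by exact: (measurable_npts _ _ (fun i => (1 < i)%N)).
have ms k : measurable (s k) by exact: (measurable_npts _ _ (fun i => (1 < i)%N)).
have ma' k : measurable (a' k) by exact: (measurable_npts _ _ (fun i => (0 < i)%N)).
have ms' k : measurable (s' k) by exact: (measurable_npts _ _ (fun i => (0 < i)%N)).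
have GE k : G k = (a k `|` s k) `|` (a' k `&` s' k).
  apply/seteqP; split=> w; rewrite /G /a /s /a' /s' /=.
    move: (npts A _ _ _) (npts S _ _ _) => x y xy.
    have [?|?] := ltnP 1 x; first by left; left.
    have [?|?] := ltnP 1 y; first by left; right.
    by right; split; lia.
  by case=> [[|]|[]]; lia.
have mG k : measurable (G k).
  by rewrite GE; apply: measurableU; [exact: measurableU|exact: measurableI].
apply: (le_trans (pr_bigsetU P (F := fun k : 'I_N => G k) _)) => //.
rewrite -[N in N%:R]card_ord -sum1_card natr_sum mulr_suml; apply: ler_sum => k _.
rewrite mul1r GE.
have h1 := pr_npts_gt1_le lambda0 PA (cell k); rewrite cellE in h1.
have h2 := pr_npts_gt1_le mu0 PS (cell k); rewrite cellE in h2.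
have h3 := pr_npts_gt0_le lambda0 PA (ltW (cell k)); rewrite cellE in h3.
have h4 := pr_npts_gt0_le mu0 PS (ltW (cell k)); rewrite cellE in h4.
have h5 : pr P (a' k `&` s' k) <= (lambda * h) * (mu * h).
  rewrite (pr_independent AS).
  - by apply: ler_pM => //; exact: pr_ge0.
  - exact: (sigma_process_npts _ _ (fun m => (0 < m)%N)).
  - exact: (sigma_process_npts _ _ (fun m => (0 < m)%N)).
apply: (@le_trans _ _ (pr P (a k) + pr P (s k) + pr P (a' k `&` s' k))).
  apply: (le_trans (pr_setU _ _ _)); [exact: measurableU|exact: measurableI|].
  by rewrite lerD2r; exact: pr_setU.
apply: (le_trans (lerD (lerD h1 h2) h5)).
have : 0 <= (lambda * h) * (mu * h) by rewrite !mulr_ge0// ltW.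
move: (lambda * h) (mu * h) (mulrDl lambda mu h) => x y -> ?; nra.
Qed.

End input_bits_law.

(** * Equality of the finite-dimensional laws *)

Lemma pr_dist_le (R : realType) (d : measure_display) (Omega : measurableType d)
  (P : probability Omega R) (E F bad : set Omega) :
  measurable E -> measurable F -> measurable bad ->
  (forall w, ~ bad w -> E w <-> F w) -> `|pr P E - pr P F| <= pr P bad.
Proof.
move=> mE mF mbad EF; rewrite ler_distl; apply/andP; split.
  rewrite lerBlDr; apply: le_pr_setU => // w Fw.
  by have [|/EF[_ ]] := pselect (bad w); [right|left; auto].
apply: le_pr_setU => // w Ew.
by have [|/EF[]] := pselect (bad w); [right|left; auto].
Qed.

Section transfer.
Context (R : realType) (d : measure_display) (Omega : measurableType d)
  (P : probability Omega R) (lambda mu : R) (A S D U T : R.-ker Omega ~> R).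
Hypotheses (lambda0 : 0 < lambda) (lambda_mu : lambda < mu)
  (PA : poisson_process P lambda A) (PS : poisson_process P mu S)
  (AS : independent_processes P A S) (out : mm1_outputs P A S D U T).

Let mu0 : 0 < mu. Proof. exact: lt_trans lambda0 lambda_mu. Qed.
Let pA : point_process A. Proof. by case: PA. Qed.
Let pS : point_process S. Proof. by case: PS. Qed.
Let pD : point_process D. Proof. by case: out => -[]. Qed.
Let pU : point_process U. Proof. by case: out => _ []. Qed.
Let pT : point_process T. Proof. by case: out => _ _ []. Qed.

Let inp (k : bool) := if k then A else S.
Let outp (k : bool) := if k then D else T.

Lemma mm1_outputs_ae : exists Z : set Omega, [/\ measurable Z, pr P Z = 0 &
  forall w, ~ Z w -> [/\ forall s t : R, s < t -> D w `]s, t]%classic =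
      (A w `]s, t]%classic + queue_length A S w s - queue_length A S w t)%E,
    forall B : set R, measurable B -> bounded_set B -> U w B = (S w B - D w B)%E &
    forall B : set R, measurable B -> T w B = (A w B + U w B)%E] ].
Proof.
case: out => -[_ [Z1 [m1 P1 H1]]] [_ [Z2 [m2 P2 H2]]] [_ [Z3 [m3 P3 H3]]].
exists (Z1 `|` Z2 `|` Z3); split.
- by apply: measurableU => //; exact: measurableU.
- apply/eqP; rewrite eq_le pr_ge0 andbT.
  apply: (le_trans (pr_setU _ (measurableU _ _ m1 m2) m3)).
  apply: (le_trans (lerD (pr_setU _ m1 m2) (lexx _))).
  have pr0 Z : P Z = 0%E -> pr P Z = 0 by rewrite /pr => ->.
  by rewrite (pr0 _ P1) (pr0 _ P2) (pr0 _ P3) !addr0.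
- move=> w nZ; split.
  + by apply: contrapT => /H1 ?; apply: nZ; left; left.
  + by apply: contrapT => /H2 ?; apply: nZ; left; right.
  + by apply: contrapT => /H3 ?; apply: nZ; right.
Qed.

(** The grid starts at [b] and ends at [L], with step [n.+1%:R^-1]; the queue is
    started empty at [b] and observed after [t0 = - L]. The margin 1 in the
    hypotheses on the endpoints leaves room for rounding up. *)
Section window.
Variables (I : finType) (k : I -> bool) (s t : I -> R) (C : I -> set nat).
Variables (L M K n : nat).
Hypotheses (sL : forall i, `|s i| + 1 <= L%:R) (tL : forall i, `|t i| + 1 <= L%:R).

Let h : R := n.+1%:R^-1.
Let t0 : R := - L%:R.
Let b : R := t0 - M%:R.
Let m0 := (M * n.+1)%N.
Let N := ((L + L + M) * n.+1)%N.

Let h0 : 0 < h. Proof. by rewrite invr_gt0. Qed.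
Let h1 : h <= 1. Proof. by rewrite invf_le1 ?ler1n. Qed.
Let grid_m0 : grid b h m0 = t0.
Proof. by rewrite /grid /m0 natrM mulfK// /b subrK. Qed.
Let grid_N : grid b h N = L%:R.
Proof. by rewrite /grid /N natrM mulfK// /b /t0 !natrD; ring. Qed.
Let m0N : (m0 <= N)%N. Proof. by rewrite leq_mul2r leq_addl orbT. Qed.

Let gap X (u : R) : set Omega :=
  [set w | (0 < npts X u (grid b h (round_up b h u)) w)%N].

Let gaps : set Omega := \bigcup_i
  ((gap A (s i) `|` gap A (t i)) `|` (gap S (s i) `|` gap S (t i))).

Let measurable_gap X u : point_process X -> measurable (gap X u).
Proof. by move=> pX; exact: (measurable_npts _ _ (fun m => (0 < m)%N)). Qed.

Let b_le u : `|u| + 1 <= L%:R -> b <= u.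
Proof.
move=> uL; have := ler_norm (- u); rewrite normrN.
have : 0 <= M%:R :> R by [].
by move: uL; rewrite /b /t0; move: (`|u|) (L%:R) (M%:R) => x y z; lra.
Qed.

Let pr_gap X r u : 0 < r -> poisson_process P r X -> `|u| + 1 <= L%:R ->
  pr P (gap X u) <= r * h.
Proof.
move=> r0 PX uL; have [lo hi] := round_upP h0 (b_le uL).
apply: (le_trans (pr_npts_gt0_le r0 PX lo)).
by rewrite ler_pM2l// lerBlDl.
Qed.

Let measurable_gaps : measurable gaps.
Proof.
apply: fin_bigcup_measurable => [|i _]; first exact: finite_finset.
by apply: measurableU; apply: measurableU; exact: measurable_gap.
Qed.

Let pr_gaps : pr P gaps <= #|I|%:R * (2 * (lambda + mu) * h).
Proof.
apply: (le_trans (pr_bigsetU P _)) => [i|].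
  by apply: measurableU; apply: measurableU; exact: measurable_gap.
rewrite -sum1_card natr_sum mulr_suml; apply: ler_sum => i _; rewrite mul1r.
apply: (le_trans (pr_setU _ _ _)); [by apply: measurableU; exact: measurable_gap..|].
apply: (le_trans (lerD (pr_setU _ _ _) (pr_setU _ _ _))); [exact: measurable_gap..|].
apply: (le_trans (lerD (lerD (pr_gap lambda0 PA (sL i)) (pr_gap lambda0 PA (tL i)))
  (lerD (pr_gap mu0 PS (sL i)) (pr_gap mu0 PS (tL i))))).
by rewrite le_eqVlt; apply/orP; left; apply/eqP; ring.
Qed.

Let crowd := crowded A S b h N.
Let over := \bigcup_(m in [set m | (M <= m)%N]) overload A S t0 K m.

Let measurable_over : measurable over.
Proof. by apply: bigcup_measurable => m _; exact: measurable_overload. Qed.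

Let f := input_bits A S b h N.

(** The bad event is paid three times: to pass from the output counts to the
    output bits, to merge the empty queue with the one in equilibrium, and to pass
    from the input bits to the input counts. *)
Lemma transfer_le (Z : set Omega) : measurable Z -> pr P Z = 0 ->
  (forall w, ~ Z w -> [/\ forall s t : R, s < t -> D w `]s, t]%classic =
      (A w `]s, t]%classic + queue_length A S w s - queue_length A S w t)%E,
    forall B : set R, measurable B -> bounded_set B -> U w B = (S w B - D w B)%E &
    forall B : set R, measurable B -> T w B = (A w B + U w B)%E]) ->
  `|pr P (\bigcap_i [set w | C i (npts (outp (k i)) (s i) (t i) w)]) -
    pr P (\bigcap_i [set w | C i (npts (inp (k i)) (s i) (t i) w)])| <=
  3 * (pr P over + ((L + L + M)%:R * (lambda + mu) ^+ 2
     + #|I|%:R * (2 * (lambda + mu))) * h) + (lambda / mu) ^+ K.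
Proof.
move=> mZ PZ HZ.
pose bad := Z `|` (over `|` (crowd `|` gaps)).
have mbad : measurable bad.
  apply: measurableU => //; apply: measurableU => //; apply: measurableU => //.
  by exact: measurable_crowded.
have prbad : pr P bad <= pr P over + ((L + L + M)%:R * (lambda + mu) ^+ 2
     + #|I|%:R * (2 * (lambda + mu))) * h.
  apply: (le_trans (pr_setU _ _ _)) => //.
    by apply: measurableU => //; apply: measurableU => //; exact: measurable_crowded.
  rewrite PZ add0r; apply: (le_trans (pr_setU _ _ _)) => //.
    by apply: measurableU => //; exact: measurable_crowded.
  rewrite lerD2l; apply: (le_trans (pr_setU _ _ _)) => //; first exact: measurable_crowded.
  have := pr_crowded lambda0 mu0 PA PS AS b N h0.
  rewrite (_ : N%:R * _ = (L + L + M)%:R * (lambda + mu) ^+ 2 * h); last first.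
    by rewrite /N natrM /h; field.
  move=> h2; apply: (le_trans (lerD h2 pr_gaps)).
  by rewrite le_eqVlt; apply/orP; left; apply/eqP; ring.
pose F (l : seq (bool * bool)) : bool := `[< forall i,
  C i (count_marks (k i) (segment (round_up b h (s i)) (round_up b h (t i)) l)) >].
have npts_m X u v (G : set nat) : point_process X -> measurable [set w | G (npts X u v w)].
  by move=> pX; exact: (measurable_npts _ _ G).
have mIO (X : bool -> R.-ker Omega ~> R) : (forall e, point_process (X e)) ->
   measurable (\bigcap_i [set w | C i (npts (X (k i)) (s i) (t i) w)]).
  move=> pX; apply: fin_bigcap_measurable => [|i _]; first exact: finite_finset.
  exact: npts_m.
have mlF l : size l = N -> measurable [set w | f w = l] by exact: measurable_input_bits.
have plF l := @pr_input_bits _ _ _ _ _ _ _ _ lambda0 mu0 PA PS AS b h N h0 l.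
have szf w : size (f w) = N by exact: size_bits.
have mF := measurable_bits szf mlF plF.
set p := 1 - expR (- (lambda * h)); set q := 1 - expR (- (mu * h)).
have p0 : 0 < p by rewrite subr_gt0 expR_lt1 oppr_lt0 mulr_gt0.
have pq : p < q by rewrite ltrD2l ltrN2 ltr_expR ltrN2 ltr_pM2r.
have q1 : q < 1 by rewrite gtrBl expR_gt0.
have good w : ~ bad w -> [/\
    forall i, npts (inp (k i)) (s i) (t i) w =
      count_marks (k i) (segment (round_up b h (s i)) (round_up b h (t i)) (f w)),
    forall i, npts (outp (k i)) (s i) (t i) w =
      count_marks (k i) (segment (round_up b h (s i)) (round_up b h (t i)) (orun 0 (f w))) &
    forall i j, (i < K)%N ->
     segment (round_up b h (s j)) (round_up b h (t j)) (orun i (f w)) =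
     segment (round_up b h (s j)) (round_up b h (t j)) (orun 0 (f w))].
  move=> /not_orP[nZ /not_orP[nover /not_orP[ncrowd ngaps]]].
  have [dep unu tot] := HZ _ nZ.
  have sparse j : (j < N)%N -> (npts A (grid b h j) (grid b h j.+1) w +
      npts S (grid b h j) (grid b h j.+1) w <= 1)%N.
    by move=> jN; rewrite leqNgt; apply/negP => H; apply: ncrowd; exists (Ordinal jN).
  have empt u : u <= b -> (npts A u (grid b h m0) w + K <= npts S u (grid b h m0) w)%N.
    by rewrite grid_m0; exact: (emptied_after pA pS nover).
  have gapE X u : ~ gap X u w -> npts X u (grid b h (round_up b h u)) w = 0%N.
    by move=> /negP; rewrite -leqNgt leqn0 => /eqP.
  have inside u : `|u| + 1 <= L%:R -> grid b h m0 <= u /\ u + h <= grid b h N.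
    move=> uL; rewrite grid_m0 grid_N /t0.
    have := ler_norm u; have := ler_norm (- u); rewrite normrN.
    by move: uL h1; move: (`|u|) (L%:R) (h) => *; split; lra.
  have both i := @in_out_npts _ _ _ _ _ w pA pS D U T pD pU pT dep unu tot b h N m0 K h0 sparse
    m0N empt (s i) (t i) (k i).
  have gap4 i : [/\ ~ gap A (s i) w, ~ gap A (t i) w, ~ gap S (s i) w & ~ gap S (t i) w].
    by split=> g; apply: ngaps; exists i => //; [left; left|left; right|right; left|right; right].
  split=> [i|i|i j iK].
  - have [g1 g2 g3 g4] := gap4 i; have [a1 a2] := inside _ (sL i); have [a3 a4] := inside _ (tL i).
    by have [] := both i a1 a3 a2 a4 (gapE _ _ g1) (gapE _ _ g2) (gapE _ _ g3) (gapE _ _ g4).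
  - have [g1 g2 g3 g4] := gap4 i; have [a1 a2] := inside _ (sL i); have [a3 a4] := inside _ (tL i).
    by have [] := both i a1 a3 a2 a4 (gapE _ _ g1) (gapE _ _ g2) (gapE _ _ g3) (gapE _ _ g4).
  - have idx u : `|u| + 1 <= L%:R -> (m0 <= round_up b h u)%N.
      move=> uL; rewrite -(round_up_grid b h0 m0); apply: le_round_up => //.
        by rewrite -[leLHS]addr0 lerD2l mulr_ge0// ltW.
      by have [] := inside _ uL.
    by apply: (orun_merge pA pS h0 sparse m0N empt); rewrite ?idx// ltnW.
have dOut : `|pr P (\bigcap_i [set w | C i (npts (outp (k i)) (s i) (t i) w)]) -
    pr P [set w | F (orun 0 (f w))]| <= pr P bad.
  apply: pr_dist_le => //.
  - by apply: mIO; case.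
  - exact: (mF (fun l => F (orun 0 l))).
  - move=> w /good[_ e _]; split=> [H|/asboolP H].
      by apply/asboolP => i; rewrite -e; exact: H.
    by move=> i _ /=; rewrite e; exact: H.
have dIn : `|pr P [set w | F (f w)] -
    pr P (\bigcap_i [set w | C i (npts (inp (k i)) (s i) (t i) w)])| <= pr P bad.
  apply: pr_dist_le => //.
  - by apply: mIO; case.
  - move=> w /good[e _ _]; split=> [/asboolP H|H].
      by move=> i _ /=; rewrite e; exact: H.
    by apply/asboolP => i; rewrite -e; exact: H.
have dMid : `|pr P [set w | F (orun 0 (f w))] - pr P [set w | F (f w)]| <=
    pr P bad + (lambda / mu) ^+ K.
  apply: (le_trans (burke_empty szf mlF plF p0 pq q1 (K := K) (F := F) mbad _)).
    move=> i w iK /good[_ _ e]; apply: asbool_equiv_eq.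
    by split=> H j; [rewrite -(e i j iK)|rewrite (e i j iK)]; exact: H.
  rewrite lerD2l lerXn2r ?nnegrE//.
  - exact: (rho_ge0 p0 (lt_trans pq q1) (lt_trans p0 pq) q1).
  - by rewrite divr_ge0// ltW.
  - apply: (le_trans (rho_poisson_le _ _)); rewrite ?mulr_gt0 ?ltr_pM2r//.
    by rewrite -mulf_div divff ?mulr1 ?lt0r_neq0.
rewrite (_ : _ - _ = (pr P (\bigcap_i [set w | C i (npts (outp (k i)) (s i) (t i) w)]) -
    pr P [set w | F (orun 0 (f w))]) + (pr P [set w | F (orun 0 (f w))] - pr P [set w | F (f w)])
   + (pr P [set w | F (f w)] -
    pr P (\bigcap_i [set w | C i (npts (inp (k i)) (s i) (t i) w)]))); last by ring.
apply: (le_trans (ler_normD _ _)); apply: (le_trans (lerD (ler_normD _ _) dIn)).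
rewrite -addrA; apply: (le_trans (lerD dOut (lerD dMid (lexx _)))).
move: prbad; move: (pr P bad) (_ ^+ K) (pr P over + _) => x y z; lra.
Qed.

End window.

(** The left-hand side of [transfer_le] does not depend on the parameters of the
    grid: [K], then the length [M] of the warm-up, then the number [n] of cells per
    unit of time are sent to infinity. *)
Theorem transfer (I : finType) (k : I -> bool) (s t : I -> R) (C : I -> set nat) :
  pr P (\bigcap_i [set w | C i (npts (outp (k i)) (s i) (t i) w)]) =
  pr P (\bigcap_i [set w | C i (npts (inp (k i)) (s i) (t i) w)]).
Proof.
apply/eqP; rewrite -subr_eq0 -normr_le0; apply/ler_addgt0Pl => e e0; rewrite addr0.
have [Z [mZ PZ HZ]] := mm1_outputs_ae.
pose eps := e / 7; have eps0 : 0 < eps by rewrite divr_gt0.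
(* A crude common bound on the endpoints. *)
pose L := (\sum_i (Num.truncn (`|s i| + `|t i| + 1)).+1)%N.
have LP i : `|s i| + `|t i| + 1 <= L%:R.
  apply: (@le_trans _ _ (Num.truncn (`|s i| + `|t i| + 1)).+1%:R).
    by rewrite ltW// truncnS_gt.
  by rewrite ler_nat /L (bigD1 i)//= leq_addr.
have sL i : `|s i| + 1 <= L%:R.
  by apply: le_trans (LP i); rewrite lerD2r lerDl.
have tL i : `|t i| + 1 <= L%:R.
  by apply: le_trans (LP i); rewrite lerD2r lerDr.
have [K Keps] : exists K, (lambda / mu) ^+ K <= eps.
  have r1 : `|lambda / mu| < 1.
    by rewrite ger0_norm ?divr_ge0 ?ltW// ltr_pdivrMr// mul1r.
  have /cvgrPdist_le /(_ _ eps0)[K _ /(_ K (leqnn K))] := cvg_geometric 1 r1.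
  rewrite /geometric/= mul1r sub0r normrN => H; exists K; apply: le_trans H.
  exact: ler_norm.
have [M Meps] := pr_overload_tail lambda0 lambda_mu PA PS AS (- L%:R) K eps0.
pose c := (L + L + M)%:R * (lambda + mu) ^+ 2 + #|I|%:R * (2 * (lambda + mu)).
pose n := Num.truncn (c / eps).
have neps : c * n.+1%:R^-1 <= eps.
  rewrite ler_pdivrMr// mulrC -ler_pdivrMr// ltW// truncnS_gt.
  by [].
apply: (le_trans (@transfer_le I k s t C L M K n sL tL Z mZ PZ HZ)).
rewrite -/c (_ : e = 3 * (eps + eps) + eps); last by rewrite /eps; field.
by rewrite lerD// ler_pM2l// lerD.
Qed.

End transfer.

(** * Measures determined by their values on intervals *)

Section measure_families.
Context (R : realType) (d : measure_display) (T : measurableType d).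

Let window (n : nat) : set R := `]- n%:R, n%:R]%classic.

Let window_nd : nondecreasing_seq window.
Proof.
move=> m n mn; apply/subsetPset => x; rewrite /window /= !in_itv/= => /andP[a b].
rewrite (le_trans b) ?ler_nat// andbT; apply: le_lt_trans a.
by rewrite lerN2 ler_nat.
Qed.

Let window_cover : \bigcup_n window n = setT.
Proof. exact: (bigcup_itvT false false). Qed.

Let cvg_window (m : {measure set R -> \bar R}) B : measurable B ->
  m (window n `&` B) @[n --> \oo] --> m B.
Proof.
move=> mB; rewrite -{2}[B]setTI -window_cover setI_bigcupl.
apply: nondecreasing_cvg_mu.
- by move=> n; apply: measurableI => //; exact: measurable_itv.
- by apply: bigcup_measurable => n _; apply: measurableI => //; exact: measurable_itv.
- move=> i j ij; apply/subsetPset; apply: setSI.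
  exact/subsetPset/window_nd.
Qed.

(** A measurable dependence on the parameter propagates from intervals to all
    Borel sets by Dynkin's lemma, one bounded window at a time. *)
Lemma measurable_measure_family (m : T -> {measure set R -> \bar R}) :
  (forall x s t, (m x `]s, t]%classic < +oo)%E) ->
  (forall s t, measurable_fun [set: T] (fun x => m x `]s, t]%classic)) ->
  forall B, measurable B -> measurable_fun [set: T] (m ^~ B).
Proof.
move=> fin mi B mB.
suff H n : forall B, measurable B -> measurable_fun [set: T] (fun x => m x (window n `&` B)).
  apply: (emeasurable_fun_cvg (fun n x => m x (window n `&` B))) => [n|x _]; first exact: H.
  exact: cvg_window.
move=> {}B {}mB.
have mw : measurable (window n) by exact: measurable_itv.
apply: (@dynkin_induction _ R (@ocitv R)
  (fun B => measurable_fun [set: T] (fun x => m x (window n `&` B)))) => //.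
- exact: ocitvI.
- by rewrite setIT; exact: mi.
- move=> _ [[a b] _ <-] /=.
  have [[c e] _ <-] : ocitv (window n `&` `]a, b]) by apply: ocitvI; exact: is_ocitv.
  exact: mi.
- move=> S mS mmS; rewrite -setDE.
  under eq_fun do rewrite measureD ?fin//.
  by apply: emeasurable_funB => //; exact: mi.
- move=> F mF tF mmF.
  have Fx x : (m x (window n `&` \bigcup_k F k) = \sum_(k <oo) m x (window n `&` F k))%E.
    rewrite setI_bigcupr measure_semi_bigcup//.
    + by move=> i; apply: measurableI.
    + by apply: trivIset_setIl.
    + by apply: bigcup_measurable => k _; apply: measurableI.
  under eq_fun do rewrite Fx.
  by apply: ge0_emeasurable_sum.
Qed.

Lemma cvg_natr (u : nat -> nat) (l : R) : (u n)%:R @[n --> \oo] --> l -> exists k : nat, l = k%:R.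
Proof.
move=> ul; have h0 : 0 < 2^-1 :> R by rewrite invr_gt0.
have /cvgrPdist_lt /(_ _ h0) [N _ HN] := ul.
exists (u N); apply: (cvg_unique _ ul) => //.
apply: cvg_near_cst; exists N => // n Nn /=.
have := HN _ Nn; have := HN _ (leqnn N); rewrite /= => a b.
have : `|(u n)%:R - (u N)%:R| < 1 :> R.
  by move: a b; rewrite !ltr_norml; move: ((u N)%:R) ((u n)%:R) => x y; lra.
rewrite {a b} -[(u n)%:R]/((u n)%:Z%:~R) -[(u N)%:R]/((u N)%:Z%:~R) -intrB -intr_norm.
rewrite -[1]/(1%:~R) ltr_int => h; congr (_%:R); lia.
Qed.

End measure_families.

(** * From finite-dimensional laws to processes *)

Section laws.
Context (R : realType) (d : measure_display) (Omega : measurableType d)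
  (P : probability Omega R).
Implicit Types X Y : R.-ker Omega ~> R.

Definition cylinder X (I : finType) (s t : I -> R) (C : I -> set nat) : set Omega :=
  \bigcap_i [set w | C i (npts X (s i) (t i) w)].

Lemma measurable_cylinder X (I : finType) (s t : I -> R) (C : I -> set nat) :
  point_process X -> measurable (cylinder X s t C).
Proof.
move=> pX; apply: fin_bigcap_measurable => [|i _]; first exact: finite_finset.
exact: (measurable_npts _ _ (C i)).
Qed.

Lemma sigma_process_cylinder X (I : finType) (s t : I -> R) (C : I -> set nat) :
  point_process X -> sigma_process X (cylinder X s t C).
Proof.
move=> pX; apply: sigma_process_bigcap => i.
exact: (sigma_process_npts _ _ (C i)).
Qed.

Definition cylinders X : set (set Omega) :=
  [set E | exists (I : finType) (s t : I -> R) (C : I -> set nat), E = cylinder X s t C].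

Lemma cylinders_setI X : setI_closed (cylinders X).
Proof.
move=> _ _ [I1 [s1 [t1 [C1 ->]]]] [I2 [s2 [t2 [C2 ->]]]].
pose join Z (f : I1 -> Z) (g : I2 -> Z) (i : I1 + I2) :=
  match i with inl i => f i | inr i => g i end.
exists (I1 + I2)%type, (join _ s1 s2), (join _ t1 t2), (join _ C1 C2).
apply/seteqP; split=> w /=; first by move=> [H1 H2] [i|i] _ /=; [exact: H1|exact: H2].
by move=> H; split=> i _; [exact: (H (inl i))|exact: (H (inr i))].
Qed.

(** The counts of intervals are measurable for the cylinders by definition; the
    masses of all Borel sets follow from [measurable_measure_family], for the
    parameter space equipped with the sigma-algebra of the cylinders. *)
Lemma sigma_process_cylinders X : point_process X ->
  sigma_process X `<=` <<s cylinders X >>.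
Proof.
move=> pX; apply: smallest_sub; first exact: smallest_sigma_algebra.
move=> _ [B [C [mB mC ->]]].
have := @measurable_measure_family R _ (g_sigma_algebraType (cylinders X))
  (fun w => (X : Omega -> {measure set R -> \bar R}) w) _ _ B mB.
move=> H; have := H _ _ measurableT C mC; rewrite setTI; apply.
  by move=> w s t; rewrite nptsE// ltry.
move=> s t _ E mE; rewrite setTI; apply: sub_sigma_algebra.
exists unit, (fun=> s), (fun=> t), (fun=> [set k | E k%:R%:E]).
apply/seteqP; split=> w; first by move=> H' i _ /=; rewrite -nptsE.
by move=> /(_ tt I) /=; rewrite -nptsE.
Qed.

(** The pi-lambda theorem, for one of the two families; applying it to each
    family in turn gives [independent_cylinders]. *)
Lemma independent_pi (G : set (set Omega)) (F : set Omega) :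
  setI_closed G -> (forall E, G E -> measurable E) -> measurable F ->
  (forall E, G E -> P (E `&` F) = (P E * P F)%E) ->
  forall E, <<s G >> E -> P (E `&` F) = (P E * P F)%E.
Proof.
move=> GI Gm mF GF.
suff : <<s G >> `<=` [set E | measurable E /\ P (E `&` F) = (P E * P F)%E] by move=> H E /H[].
apply: lambda_system_subset => //; last by move=> E GE; split; [exact: Gm|exact: GF].
apply/dynkin_lambda_system; split => /=.
- by split => //; rewrite setTI probability_setT mul1e.
- move=> E [mE EF]; split; first exact: measurableC.
  rewrite setIC -setDE measureD//; last by rewrite ltey_eq fin_num_measure.
  rewrite setIC [X in (_ - X)%E]EF probability_setC//.
  by rewrite muleBl ?fin_num_measure// mul1e.
- move=> H tH mH; split; first by apply: bigcup_measurable => k _; exact: (mH k).1.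
  rewrite setI_bigcupl !measure_semi_bigcup//.
  + rewrite (prE P mF) muleC -nneseriesZl//; apply: eq_eseriesr => k _.
    by rewrite -(prE P mF) muleC; exact: (mH k).2.
  + by move=> k; exact: (mH k).1.
  + by apply: bigcup_measurable => k _; exact: (mH k).1.
  + by move=> k; apply: measurableI => //; exact: (mH k).1.
  + by apply: trivIset_setIr.
  + by apply: bigcup_measurable => k _; apply: measurableI => //; exact: (mH k).1.
Qed.

Lemma independent_cylinders X Y : point_process X -> point_process Y ->
  (forall (I J : finType) s t C s' t' C',
    P (@cylinder X I s t C `&` @cylinder Y J s' t' C') =
    (P (cylinder X s t C) * P (cylinder Y s' t' C'))%E) ->
  independent_processes P X Y.
Proof.
move=> pX pY H E F sE sF.
have mF : measurable F := sigma_process_measurable sF.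
have cm Z E' : point_process Z -> cylinders Z E' -> measurable E'.
  by move=> pZ [I [s [t [C ->]]]]; exact: measurable_cylinder.
apply: (@independent_pi (cylinders X)) => //.
- exact: cylinders_setI.
- by move=> ?; exact: cm.
- move=> E' cE; rewrite setIC muleC.
  apply: (@independent_pi (cylinders Y)) => //.
  + exact: cylinders_setI.
  + by move=> ?; exact: cm.
  + exact: cm cE.
  + move=> F' cF; rewrite setIC muleC.
    by case: cE cF => [I [s [t [C ->]]]] [J [s' [t' [C' ->]]]].
  + exact: sigma_process_cylinders.
- exact: sigma_process_cylinders.
Qed.

Lemma poisson_process_law X Y (r : R) : point_process X ->
  (forall (I : finType) (s t : I -> R) C, pr P (cylinder X s t C) = pr P (cylinder Y s t C)) ->
  poisson_process P r Y -> poisson_process P r X.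
Proof.
move=> pX XY [pY PY IY].
have cyl1 Z s t (C : set nat) :
    [set w | C (npts Z s t w)] = @cylinder Z unit (fun=> s) (fun=> t) (fun=> C).
  by apply/seteqP; split=> w; [move=> ? []|move=> /(_ tt I)].
have e1 s t (C : set nat) : pr P [set w | C (npts X s t w)] = pr P [set w | C (npts Y s t w)].
  by rewrite !cyl1.
have cnt (Z : R.-ker Omega ~> R) s t (C : set (\bar R)) : point_process Z ->
    [set w | C (Z w `]s, t]%classic)] = [set w | [set k | C k%:R%:E] (npts Z s t w)].
  by move=> pZ; apply/seteqP; split=> w /=; rewrite nptsE.
have cntp (Z : R.-ker Omega ~> R) s t (C : set (\bar R)) : point_process Z ->
    (fun w => Z w `]s, t]%classic) @^-1` C = [set w | [set k | C k%:R%:E] (npts Z s t w)].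
  exact: cnt.
split=> //.
- move=> s t k st; rewrite -(PY s t k st).
  rewrite (cnt X s t [set k%:R%:E])// (cnt Y s t [set k%:R%:E])// !prE ?e1//;
    exact: (measurable_npts _ _ [set j | [set k%:R%:E] j%:R%:E]).
- move=> n s t st triv C mC; have := IY n s t st triv C mC.
  have all Z : point_process Z -> [set w | forall i, C i (Z w `]s i, t i]%classic)] =
      cylinder Z s t (fun i => [set k | C i k%:R%:E]).
    move=> pZ; apply/seteqP; split=> w H i; first by move=> _ /=; rewrite -nptsE.
    by have := H i I; rewrite /= -nptsE.
  rewrite !all// !prE; [|exact: measurable_cylinder..].
  rewrite XY => ->; apply: eq_bigr => i _.
  rewrite (cntp X (s i) (t i) (C i))// (cntp Y (s i) (t i) (C i))// !prE ?e1//;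
    exact: (measurable_npts _ _ [set j | C i j%:R%:E]).
Qed.

End laws.

Section burke.
Context (R : realType) (d : measure_display) (Omega : measurableType d)
  (P : probability Omega R) (lambda mu : R) (A S D U T : R.-ker Omega ~> R).
Hypotheses (lambda0 : 0 < lambda) (lambda_mu : lambda < mu)
  (PA : poisson_process P lambda A) (PS : poisson_process P mu S)
  (AS : independent_processes P A S) (out : mm1_outputs P A S D U T).

Theorem burke : [/\ poisson_process P lambda D, poisson_process P mu T
  & independent_processes P D T].
Proof.
have pA : point_process A by case: PA.
have pS : point_process S by case: PS.
have pD : point_process D by case: out => -[].
have pT : point_process T by case: out => _ _ [].
have tr := @transfer _ _ _ _ _ _ _ _ _ _ _ lambda0 lambda_mu PA PS AS out.
have eD (I : finType) (s t : I -> R) C : pr P (cylinder D s t C) = pr P (cylinder A s t C).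
  exact: (tr I (fun=> true) s t C).
have eT (I : finType) (s t : I -> R) C : pr P (cylinder T s t C) = pr P (cylinder S s t C).
  exact: (tr I (fun=> false) s t C).
split; [exact: poisson_process_law PA|exact: poisson_process_law PS|].
apply: independent_cylinders => // I J s t C s' t' C'.
rewrite !prE; [|exact: measurable_cylinder|exact: measurable_cylinder|]; last first.
  by apply: measurableI; exact: measurable_cylinder.
rewrite -EFinM eD eT -(pr_independent AS); [|exact: sigma_process_cylinder..].
congr EFin.
pose join Z (f : I -> Z) (g : J -> Z) (i : I + J) :=
  match i with inl i => f i | inr i => g i end.
have both (X Y : R.-ker Omega ~> R) : cylinder X s t C `&` cylinder Y s' t' C' =
  \bigcap_(i : (I + J)%type) [set w | join _ C C' i (npts
    (if join _ (fun=> true) (fun=> false) i then X else Y) (join _ s s' i) (join _ t t' i) w)].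
  apply/seteqP; split=> w /=; first by move=> [H1 H2] [i|i] _ /=; [exact: H1|exact: H2].
  by move=> H; split=> i _; [exact: (H (inl i))|exact: (H (inr i))].
by rewrite !both; exact: tr.
Qed.

End burke.

(** * Point processes from cumulative functions *)

Section integer_valued.
Context (R : realType) (m : {measure set R -> \bar R}).
Hypothesis mI : forall s t : R, exists k : nat, m `]s, t]%classic = k%:R%:E.

(** Integrality passes to differences and to convergent unions, so that
    Dynkin's lemma applies inside a bounded interval. *)
Lemma integer_valued_bounded (B : set R) : measurable B -> bounded_set B ->
  exists k : nat, m B = k%:R%:E.
Proof.
move=> mB [M [_ BM]].
have [s [t Bst]] : exists s t, B `<=` `]s, t]%classic.
  exists (- (M + 2)), (M + 1) => x /BM/= /(_ (M + 1)); rewrite ltrDl ltr01 => /(_ isT).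
  rewrite ler_norml in_itv/= => /andP[h ->]; rewrite andbT.
  by move: h; move: (M) => y; lra.
pose I : set R := `]s, t]%classic; have mst : measurable I by exact: measurable_itv.
have Ifin : (m I < +oo)%E by have [k ->] := mI s t; rewrite ltry.
rewrite -(setIidr Bst) -/I => {BM Bst}.
have natB (x : \bar R) (a b : nat) : (x = a%:R%:E - b%:R%:E)%E -> (0 <= x)%E ->
   exists k : nat, x = k%:R%:E.
  move=> ->; rewrite -EFinB lee_fin subr_ge0 ler_nat => ba.
  by exists (a - b)%N; rewrite natrB.
apply: (@dynkin_induction _ R (@ocitv R) (fun B => exists k : nat, m (I `&` B) = k%:R%:E)) => //.
- exact: ocitvI.
- by rewrite setIT; exact: mI.
- move=> _ [[a b] _ <-] /=.
  have [[c e] _ <-] : ocitv (I `&` `]a, b]) by apply: ocitvI; exact: is_ocitv.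
  exact: mI.
- move=> E mE [k Ek]; rewrite -setDE; have [j Ij] := mI s t.
  apply: (natB _ j k) => //.
  by rewrite measureD//; congr (_ - _)%E.
- move=> F mF tF FI; pose u n := I `&` \big[setU/set0]_(k < n) F k.
  have mu' n : measurable (u n).
    by apply: measurableI => //; exact: bigsetU_measurable.
  have uI n : exists k : nat, m (u n) = k%:R%:E.
    elim: n => [|n [k IH]]; first by exists 0%N; rewrite /u big_ord0 setI0 measure0.
    have [j jE] := FI n; exists (k + j)%N.
    rewrite /u big_ord_recr /= setIUr measureU//.
    + by rewrite natrD EFinD -IH -jE.
    + exact: (mu' n).
    + exact: measurableI.
    + rewrite setIACA setIid (@trivIset_bigsetUI _ predT)//; first by rewrite setI0.
      exact: sub_trivIset tF.
  have /choice[v vE] := uI.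
  have mcup : measurable (I `&` \bigcup_k F k).
    by apply: measurableI => //; exact: bigcup_measurable.
  have : m (u n) @[n --> \oo] --> m (I `&` \bigcup_k F k).
    have -> : I `&` \bigcup_k F k = \bigcup_n u n.
      rewrite -setI_bigcupr; congr (_ `&` _); apply/seteqP; split=> x.
        by move=> [k _ Fk]; exists k.+1 => //; rewrite big_ord_recr/=; right.
      by move=> [n _]; rewrite -bigcup_mkord => -[k _ Fk]; exists k.
    apply: nondecreasing_cvg_mu => //; first exact: bigcup_measurable.
    by move=> i j ij; apply/subsetPset; apply: setIS; exact: subset_bigsetU.
  have cfin : m (I `&` \bigcup_k F k) \is a fin_num.
    rewrite ge0_fin_numE// (le_lt_trans _ Ifin)// measureIl//; exact: bigcup_measurable.
  rewrite -{1}(fineK cfin) => /fine_cvgP[_ /=].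
  under eq_fun do rewrite vE.
  by move=> /cvg_natr[k e]; exists k; rewrite -e fineK.
Qed.

End integer_valued.

Section cumulative_kernel.
Context (R : realType).

Section one_path.
Variable H : R -> R.
Hypothesis Hnat : forall s t, s <= t -> exists n : nat, H t - H s = n%:R.
Hypothesis Hright : forall s, exists2 e, 0 < e & H (s + e) = H s.

Let H_nd : nondecreasing H.
Proof. by move=> s t /Hnat[n e]; rewrite -subr_ge0 e. Qed.

Let H_rc : right_continuous H.
Proof.
move=> s; have [e e0 He] := Hright s.
apply: cvg_near_cst; near=> t.
apply/eqP; rewrite eq_le; apply/andP; split.
  rewrite -He; apply: H_nd; near: t; apply: nbhs_right_le; rewrite ltrDl; exact: e0.
by apply: H_nd; near: t; exact: nbhs_right_ge.
Unshelve. all: by end_near. Qed.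

HB.instance Definition _ := isCumulative.Build R _ R H H_nd H_rc.

(** The measure is rebuilt because the Lebesgue-Stieltjes measure is typed
    with another copy of the Borel sigma-algebra. *)
Lemma measure_of_cumulative : exists m : {measure set R -> \bar R},
  forall s t, s <= t -> m `]s, t]%classic = (H t - H s)%:E.
Proof.
pose f : cumulative R R := H.
pose m0 : set R -> \bar R := lebesgue_stieltjes_measure f.
have m00 : m0 set0 = 0%E by exact: measure0.
have m0_ge0 B : (0 <= m0 B)%E by exact: measure_ge0.
have m0_add : semi_sigma_additive m0.
  exact: (@measure_semi_sigma_additive _ _ _ (lebesgue_stieltjes_measure f)).
pose M := isMeasure.Build _ R R m0 m00 m0_ge0 m0_add.
exists (HB.pack_for {measure set R -> \bar R} m0 M) => s t st /=.
rewrite /m0 /lebesgue_stieltjes_measure /measure_extension.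
rewrite measurable_mu_extE/=; last exact: is_ocitv.
by rewrite wlength_itv_bnd.
Qed.

End one_path.

Lemma kernel_of_cumulative (d : measure_display) (Omega : measurableType d) (H : Omega -> R -> R) :
  (forall w s t, s <= t -> exists n : nat, H w t - H w s = n%:R) ->
  (forall w s, exists2 e, 0 < e & H w (s + e) = H w s) ->
  (forall t, measurable_fun [set: Omega] (H ^~ t)) ->
  exists2 K : R.-ker Omega ~> R, point_process K &
  forall w s t, s <= t -> K w `]s, t]%classic = (H w t - H w s)%:E.
Proof.
move=> Hnat Hright mH.
have /choice[m mE] w := measure_of_cumulative (Hnat w) (Hright w).
have mI w s t : exists k : nat, m w `]s, t]%classic = k%:R%:E.
  have [st|ts] := lerP s t; first by have [n e] := Hnat w s t st; exists n; rewrite mE// e.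
  by exists 0%N; rewrite set_itv_ge ?measure0// bnd_simp -leNgt ltW.
have mm B : measurable B -> measurable_fun [set: Omega] (m ^~ B).
  apply: measurable_measure_family => [w s t|s t].
    by have [k ->] := mI w s t; rewrite ltry.
  have [st|ts] := lerP s t.
    under eq_fun do rewrite mE//.
    by apply/measurable_EFinP; exact: measurable_funB.
  under eq_fun do rewrite set_itv_ge ?measure0 ?bnd_simp -?leNgt ?(ltW ts)//.
  exact: measurable_cst.
pose Kmix := isKernel.Build _ _ Omega R R m mm.
exists (HB.pack_for (R.-ker Omega ~> R) m Kmix) => [w B mB bB /=|w s t /=]; last exact: mE.
exact: integer_valued_bounded.
Qed.

End cumulative_kernel.

(** * Paths with a finite queue *)

Section regularity.
Context (R : realType) (d : measure_display) (Omega : measurableType d).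
Implicit Types X : R.-ker Omega ~> R.

Lemma npts_right X w s : point_process X ->
  exists2 e, 0 < e & npts X s (s + e) w = 0%N.
Proof.
move=> pX; pose F (n : nat) : set R := `]s, s + n.+1%:R^-1]%classic.
have mF n : measurable (F n) by exact: measurable_itv.
have F0 : \bigcap_n F n = set0.
  apply/seteqP; split=> // x /= H.
  have sx : s < x by have := H 0%N I; rewrite /F/= in_itv/= => /andP[].
  pose n := Num.truncn (x - s)^-1.
  have := H n I; rewrite /F /= in_itv/= => /andP[_]; rewrite leNgt -ltrBrDl => /negP; apply.
  have xs0 : 0 < x - s by rewrite subr_gt0.
  by rewrite -[x - s]invrK ltf_pV2 ?posrE ?invr_gt0// truncnS_gt.
have : (X w \o F) n @[n --> \oo] --> X w (\bigcap_n F n).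
  apply: nonincreasing_cvg_mu => //; rewrite ?F0//.
    by rewrite /F nptsE// ltry.
  move=> m n mn; apply/subsetPset => x; rewrite /F /= !in_itv/= => /andP[-> h]/=.
  by rewrite (le_trans h)// lerD2l lef_pV2 ?posrE// ler_nat.
rewrite F0 measure0 => /fine_cvgP[_ /cvgrPdist_lt /(_ _ ltr01)[n _ /(_ n (leqnn n))]].
rewrite /= /F nptsE//= sub0r normrN ger0_norm// ltrn1 => /eqP h.
by exists n.+1%:R^-1; [rewrite invr_gt0|move: h; rewrite subn1].
Qed.

Lemma npts_shift X w s e x t : point_process X -> s <= x -> x <= s + e -> x <= t ->
  npts X s (s + e) w = 0%N -> npts X x t w = npts X s t w.
Proof.
move=> pX sx xe xt; rewrite (nptsD w pX sx xe) (nptsD w pX sx xt); lia.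
Qed.

(** A primitive of the point process: one of the two terms vanishes, according to
    the sign of [t]. *)
Definition cumul X (w : Omega) (t : R) : R := (npts X 0 t w)%:R - (npts X t 0 w)%:R.

Lemma cumulB X w s t : point_process X -> s <= t ->
  cumul X w t - cumul X w s = (npts X s t w)%:R.
Proof.
move=> pX st; rewrite /cumul; have [t0|t0] := lerP 0 t.
  rewrite (npts0 X w t0) subr0; have [s0|s0] := lerP 0 s.
    by rewrite (npts0 X w s0) subr0 (nptsD w pX s0 st) natrD addrAC subrr add0r.
  by rewrite (npts0 X w (ltW s0)) sub0r opprK (nptsD w pX (ltW s0) t0) natrD addrC.
have s0 := le_lt_trans st t0.
rewrite (npts0 X w (ltW t0)) (npts0 X w (ltW s0)) !sub0r opprK.
by rewrite (nptsD w pX st (ltW t0)) natrD addrC addrK.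
Qed.

Lemma measurable_nat (g : Omega -> nat) : (forall k, measurable [set w | (k <= g w)%N]) ->
  measurable_fun [set: Omega] (fun w => (g w)%:R : R).
Proof.
move=> mg _ B mB; rewrite setTI.
have -> : (fun w => (g w)%:R : R) @^-1` B = \bigcup_(k in [set k | B k%:R])
   ([set w | (k <= g w)%N] `\` [set w | (k.+1 <= g w)%N]).
  apply/seteqP; split=> w /=.
    by move=> Bw; exists (g w) => //=; split=> //; rewrite ltnn.
  move=> [k /= Bk [kg /negP]]; rewrite -leqNgt => gk.
  by have -> : g w = k by apply/eqP; rewrite eqn_leq gk kg.
by apply: bigcup_measurable => k _; exact: measurableD.
Qed.

Lemma measurable_cumul X t : point_process X -> measurable_fun [set: Omega] (cumul X ^~ t).
Proof.
move=> pX; apply: measurable_funB; apply: measurable_nat => k;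
  exact: (measurable_npts _ _ (fun i => (k <= i)%N)).
Qed.

End regularity.

Section stable_paths.
Context (R : realType) (d : measure_display) (Omega : measurableType d)
  (A S : R.-ker Omega ~> R).
Hypotheses (pA : point_process A) (pS : point_process S).
Implicit Types (w : Omega) (s t : R).

Definition stable : set Omega :=
  [set w | exists M : nat, forall s, s <= - M%:R -> (npts A s 0 w <= npts S s 0 w)%N].

Definition is_queue w t q :=
  (forall s, s <= t -> (npts A s t w <= npts S s t w + q)%N) /\
  (exists2 s, s <= t & npts A s t w = (npts S s t w + q)%N).

(** The load at [t] is bounded over all starting times: those before [b] are
    compared at [o], where they are harmless, and those after [b] see at most the
    arrivals since [b]. *)
Lemma bounded_load w b o t : b <= o ->
  (forall s, s <= b -> (npts A s o w <= npts S s o w)%N) ->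
  forall s, s <= t -> (npts A s t w <=
    npts S s t w + (npts A b t w + npts A o t w + npts S t o w))%N.
Proof.
move=> bo H s st; have [sb|bs] := lerP s b; last first.
  by have := nptsD w pA (ltW bs) st; lia.
have h := H s sb; have so := le_trans sb bo.
have [ot|to] := lerP o t.
  by have := nptsD w pA so ot; have := nptsD w pS so ot; lia.
by have := nptsD w pA st (ltW to); have := nptsD w pS st (ltW to); lia.
Qed.

Lemma stable_queue w t : stable w -> exists q, is_queue w t q.
Proof.
move=> [M H]; have b0 : - M%:R <= 0 :> R by rewrite oppr_le0.
have /(_ t) := bounded_load b0 H; move: (_ + _ + _)%N => bound le_bound.
pose attained q := `[< exists2 s, s <= t & npts A s t w = (npts S s t w + q)%N >].
have att0 : exists q, attained q.
  by exists 0%N; apply/asboolP; exists t => //; rewrite !npts0.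
have attB q : attained q -> (q <= bound)%N.
  by move=> /asboolP[s st e]; have := le_bound s st; rewrite e leq_add2l.
exists (ex_maxn att0 attB); case: ex_maxnP => q /asboolP aq maxq; split=> // s st.
rewrite leqNgt; apply/negP => lt; have := maxq (npts A s t w - npts S s t w)%N.
have -> : attained (npts A s t w - npts S s t w)%N by apply/asboolP; exists s => //; lia.
by move=> /(_ isT); lia.
Qed.

Definition qlen w t : nat := Num.truncn (fine (queue_length A S w t)).

Lemma qlenP w t : stable w ->
  queue_length A S w t = (qlen w t)%:R%:E /\ is_queue w t (qlen w t).
Proof.
move=> /(@stable_queue w t)[q [q1 q2]].
have e := queue_lengthE pA pS q1 q2.
by rewrite /qlen e/= natrK; split=> //; split.
Qed.

(** These two bounds make the increments of D and of U nonnegative. *)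
Lemma qlen_balance w s t : stable w -> s <= t ->
  (qlen w t <= npts A s t w + qlen w s)%N /\
  (npts A s t w + qlen w s <= npts S s t w + qlen w t)%N.
Proof.
move=> sw st; have [_ [s1 [r rs e]]] := qlenP s sw; have [_ [t1 [u ut e']]] := qlenP t sw.
split.
  have [us|su] := lerP u s.
    have := s1 u us; have := nptsD w pA us st; have := nptsD w pS us st; lia.
  have := nptsD w pA (ltW su) ut; lia.
have := t1 r (le_trans rs st); have := nptsD w pA rs st; have := nptsD w pS rs st; lia.
Qed.

(** Right-continuity lets the starting time range over the rationals. *)
Lemma measurable_qlen (G : set Omega) t : measurable G -> G `<=` stable ->
  measurable_fun [set: Omega] (fun w => \1_G w * (qlen w t)%:R : R).
Proof.
move=> mG Gs; have -> : (fun w => \1_G w * (qlen w t)%:R : R) =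
    (fun w => (if `[< G w >] then qlen w t else 0%N)%:R).
  apply/funext => w; rewrite indicE; case: asboolP => sw.
    by rewrite mem_set// mul1r.
  by rewrite memNset// mul0r.
apply: measurable_nat => -[|k]; first by rewrite (_ : mkset _ = setT) //; apply/seteqP.
rewrite (_ : mkset _ = G `&` \bigcup_(q : rat)
   (if ratr q <= t then [set w | (npts S (ratr q) t w + k.+1 <= npts A (ratr q) t w)%N] else set0)).
  apply: measurableI => //; apply: bigcupT_measurable_rat => q; case: ifP => // _.
  rewrite (_ : mkset _ = \bigcup_m ([set w | npts S (ratr q) t w = m] `&`
     [set w | (m + k.+1 <= npts A (ratr q) t w)%N])).
    apply: bigcup_measurable => m _; apply: measurableI.
      exact: (measurable_npts _ _ (fun i => i = m)).
    exact: (measurable_npts _ _ (fun i => (m + k.+1 <= i)%N)).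
  apply/seteqP; split=> w /=; first by move=> ?; exists (npts S (ratr q) t w).
  by move=> [m _ [/= <-]].
apply/seteqP; split=> w /=.
  case: asboolP => // Gw kq; split=> //; have sw := Gs _ Gw.
  have [_ [_ [s st e]]] := qlenP t sw.
  have {}st : s < t.
    rewrite lt_neqAle st andbT; apply/eqP => est; move: e; rewrite est !npts0// => e.
    by move: e kq; rewrite add0n => <-.
  have [e1 e10 e1E] := npts_right w s pA; have [e2 e20 e2E] := npts_right w s pS.
  pose u := Num.min t (Num.min (s + e1) (s + e2)).
  have su : s < u by rewrite !lt_min st !ltrDl e10.
  have /rat_in_itvoo[q] := su; rewrite in_itv/= => /andP[sq qu].
  exists q => //; have qt : ratr q <= t by apply: ltW; apply: lt_le_trans qu _; rewrite ge_min lexx.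
  rewrite qt /=.
  have q1 : ratr q <= s + e1 by apply: ltW; apply: lt_le_trans qu _; rewrite !ge_min lexx !orbT.
  have q2 : ratr q <= s + e2 by apply: ltW; apply: lt_le_trans qu _; rewrite !ge_min lexx !orbT.
  rewrite (npts_shift pA (ltW sq) q1 qt e1E) (npts_shift pS (ltW sq) q2 qt e2E) e.
  by rewrite leq_add2l.
move=> [Gw [q _]]; case: ifP => // qt /= kq; have sw := Gs _ Gw.
rewrite asboolT//; have [_ [h _]] := qlenP t sw.
by have := leq_trans kq (h _ qt); rewrite leq_add2l.
Qed.

End stable_paths.

(** * Existence of the output processes *)

Section sums_of_kernels.
Context (R : realType) (d : measure_display) (Omega : measurableType d).

Lemma kernel_sum (X Y : R.-ker Omega ~> R) : exists Z : R.-ker Omega ~> R,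
  forall w B, Z w B = (X w B + Y w B)%E.
Proof.
pose m w : {measure set R -> \bar R} := measure_add (X w) (Y w).
have mm B : measurable B -> measurable_fun [set: Omega] (m ^~ B).
  move=> mB; rewrite (_ : m ^~ B = fun w => (X w B + Y w B)%E); last first.
    by apply/funext => w; exact: measure_addE.
  by apply: emeasurable_funD; exact: measurable_kernel.
pose K := isKernel.Build _ _ Omega R R m mm.
by exists (HB.pack_for (R.-ker Omega ~> R) m K) => w B; exact: measure_addE.
Qed.

Lemma eq_measure_itvoc (m1 m2 : {measure set R -> \bar R}) :
  (forall s t : R, m1 `]s, t]%classic = m2 `]s, t]%classic) ->
  (forall s t : R, (m1 `]s, t]%classic < +oo)%E) ->
  forall B, measurable B -> m1 B = m2 B.
Proof.
move=> e fin B mB.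
apply: (measure_unique (@ocitv R) (fun n : nat => `]- n%:R, n%:R]%classic)) => //.
- exact: ocitvI.
- by move=> n; exact: is_ocitv.
- exact: (bigcup_itvT false false).
- by move=> _ [[a b] _ <-]; exact: e.
Qed.

End sums_of_kernels.

Section existence.
Context (R : realType) (d : measure_display) (Omega : measurableType d)
  (P : probability Omega R) (lambda mu : R) (A S : R.-ker Omega ~> R).
Hypotheses (lambda0 : 0 < lambda) (lambda_mu : lambda < mu)
  (PA : poisson_process P lambda A) (PS : poisson_process P mu S)
  (AS : independent_processes P A S).

Let pA : point_process A. Proof. by case: PA. Qed.
Let pS : point_process S. Proof. by case: PS. Qed.

Lemma stable_ae : exists G : set Omega,
  [/\ measurable G, G `<=` stable A S & P (~` G) = 0%E].
Proof.
pose ov M := \bigcup_(m in [set m | (M <= m)%N]) overload A S 0 0 m.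
have mov M : measurable (ov M).
  by apply: bigcup_measurable => m _; exact: measurable_overload.
exists (~` \bigcap_M ov M); split.
- by apply: measurableC; exact: bigcapT_measurable.
- move=> w; rewrite setC_bigcap => -[M _ nov]; exists M => s sM.
  by rewrite -(addn0 (npts A s 0 w)); apply: (emptied_after pA pS nov); rewrite sub0r.
- rewrite setCK prE; last exact: bigcapT_measurable.
  congr EFin; apply/eqP; rewrite eq_le pr_ge0 andbT; apply/ler_addgt0Pl => e e0.
  have [M Me] := pr_overload_tail lambda0 lambda_mu PA PS AS 0 0 e0.
  rewrite addr0 (le_trans _ Me)//; apply: le_pr; [exact: bigcapT_measurable|exact: mov|].
  by move=> w; apply.
Qed.

(** The cumulative functions are set to zero off the event where the queue is
    finite, because the outputs have to be point processes for every outcome. *)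
Theorem mm1_outputs_exist : exists D U T : R.-ker Omega ~> R, mm1_outputs P A S D U T.
Proof.
have [G [mG Gs PG]] := stable_ae.
pose HD w t : R := \1_G w * (cumul A w t - (qlen A S w t)%:R).
pose HU w t : R := \1_G w * (cumul S w t - (cumul A w t - (qlen A S w t)%:R)).
have incr w s t : G w -> s <= t -> exists k : nat, [/\ HD w t - HD w s = k%:R,
    HU w t - HU w s = (npts S s t w - k)%N%:R, (k <= npts S s t w)%N &
    (k + qlen A S w t = npts A s t w + qlen A S w s)%N].
  move=> Gw st; have [b1 b2] := qlen_balance pA pS (Gs _ Gw) st.
  have cA := cumulB w pA st; have cS := cumulB w pS st.
  exists (npts A s t w + qlen A S w s - qlen A S w t)%N.
  have ks : (npts A s t w + qlen A S w s - qlen A S w t <= npts S s t w)%N by lia.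
  have e : HD w t - HD w s = (npts A s t w + qlen A S w s - qlen A S w t)%:R.
    rewrite /HD indicE mem_set// !mul1r natrB// natrD -cA; ring.
  split=> //; last by lia.
  rewrite natrB// -e -cS /HU /HD indicE mem_set// !mul1r; ring.
have out w s t : ~ G w -> HD w t - HD w s = 0 /\ HU w t - HU w s = 0.
  by move=> nG; rewrite /HD /HU indicE memNset// !mul0r subrr.
have regular w s : exists2 e, 0 < e & HD w (s + e) = HD w s /\ HU w (s + e) = HU w s.
  have [Gw|nG] := pselect (G w); last first.
    by exists 1 => //; have [/subr0_eq ? /subr0_eq ?] := out w s (s + 1) nG.
  have [e e0 eS] := npts_right w s pS; exists e => //.
  have se : s <= s + e by rewrite lerDl ltW.
  have [k [e1 e2 + _]] := incr w s (s + e) Gw se.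
  rewrite eS leqn0 => /eqP k0; move: e1 e2; rewrite k0 eS => /subr0_eq -> /subr0_eq ->.
  by [].
have mA t := @measurable_cumul R d Omega A t pA.
have mS t := @measurable_cumul R d Omega S t pS.
have mq t := @measurable_qlen R d Omega A S pA pS G t mG Gs.
have m1 : measurable_fun [set: Omega] (\1_G : Omega -> R) by exact: measurable_indic.
have mHD t : measurable_fun [set: Omega] (HD ^~ t).
  rewrite (_ : HD ^~ t = fun w => \1_G w * cumul A w t - \1_G w * (qlen A S w t)%:R).
    by apply: measurable_funB => //; exact: measurable_funM.
  by apply/funext => w; rewrite /HD mulrBr.
have mHU t : measurable_fun [set: Omega] (HU ^~ t).
  rewrite (_ : HU ^~ t = fun w => \1_G w * cumul S w t - HD w t).
    by apply: measurable_funB => //; exact: measurable_funM.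
  by apply/funext => w; rewrite /HU mulrBr.
have [||//|D pD DE] := @kernel_of_cumulative R d Omega HD.
- move=> w s t st; have [Gw|nG] := pselect (G w).
    by have [k [? _ _ _]] := incr w s t Gw st; exists k.
  by exists 0%N; rewrite (out w s t nG).1.
- by move=> w s; have [e e0 []] := regular w s; exists e.
have [||//|U pU UE] := @kernel_of_cumulative R d Omega HU.
- move=> w s t st; have [Gw|nG] := pselect (G w).
    by have [k [_ ? _ _]] := incr w s t Gw st; eexists; eassumption.
  by exists 0%N; rewrite (out w s t nG).2.
- by move=> w s; have [e e0 []] := regular w s; exists e.
have [T TE] := kernel_sum A U.
have ae (Q : Omega -> Prop) : (forall w, G w -> Q w) -> {ae P, forall w, Q w}.
  move=> GQ; exists (~` G); split=> //; first exact: measurableC.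
  by move=> w /= nQ Gw; apply: nQ; exact: GQ.
exists D, U, T; split; split=> //.
- apply: ae => w Gw s t st; have [k [e1 _ _ e]] := incr w s t Gw (ltW st).
  rewrite DE ?ltW// e1 nptsE// (qlenP pA pS s (Gs _ Gw)).1 (qlenP pA pS t (Gs _ Gw)).1.
  transitivity ((npts A s t w)%:R + (qlen A S w s)%:R - (qlen A S w t)%:R : R)%:E => //.
  by rewrite -natrD -e natrD addrK.
- apply: ae => w Gw B mB bB.
  have [j jE] := pD w B mB bB.
  have e : S w B = measure_add (D w) (U w) B.
    apply: eq_measure_itvoc => // s t; last by rewrite nptsE// ltry.
    transitivity (D w `]s, t]%classic + U w `]s, t]%classic)%E; last first.
      exact/esym/measure_addE.
    have [st|ts] := lerP s t; last first.
      by rewrite set_itv_ge ?measure0 ?adde0// bnd_simp -leNgt ltW.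
    have [k [e1 e2 kS _]] := incr w s t Gw st.
    by rewrite DE// UE// e1 e2 nptsE// -EFinD -natrD subnKC.
  rewrite e; transitivity (D w B + U w B - D w B)%E.
    by rewrite jE [(j%:R%:E + _)%E]addeC addeK.
  by congr (_ - _)%E; exact/esym/measure_addE.
- move=> w B mB bB; have [i iE] := @pA w B mB bB; have [j jE] := pU w B mB bB.
  by exists (i + j)%N; rewrite TE iE jE natrD.
- by apply: ae => w _ B _; exact: TE.
Qed.

End existence.

Theorem theorem3 (R : realType) (d : measure_display)
    (Omega : measurableType d) (P : probability Omega R)
    (lambda mu : R) (A S : R.-ker Omega ~> R)
    (lambda_gt0 : 0 < lambda) (lambda_lt_mu : lambda < mu)
    (PA : poisson_process P lambda A) (PS : poisson_process P mu S)
    (indepAS : independent_processes P A S) :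
  (exists D U T : R.-ker Omega ~> R, mm1_outputs P A S D U T) /\
  (forall D U T : R.-ker Omega ~> R, mm1_outputs P A S D U T ->
     [/\ poisson_process P lambda D, poisson_process P mu T
       & independent_processes P D T]).
Proof.
split; first exact: (mm1_outputs_exist lambda_gt0 lambda_lt_mu PA PS indepAS).
by move=> D U T; exact: burke.
Qed.
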